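(* Let $\Bbbk$ be a field and let $H$ be a noetherian AS-Gorenstein Hopf algebra over $\Bbbk$. Then the antipode of $H$ is bijective.
   Context: Noetherian means left and right noetherian. ${}_\varepsilon\Bbbk$ (resp. $\Bbbk_\varepsilon$) is the left (resp. right) one-dimensional trivial $H$-module given by the counit $\varepsilon$ of $H$. $\operatorname{Ext}_H$ is computed in left $H$-modules and $\operatorname{Ext}_{H^{\mathrm{op}}}$ in right $H$-modules. A noetherian Hopf algebra $H$ is AS-Gorenstein (Artin–Schelter Gorenstein) if, for some integer $d$: (AS1) the injective dimension of the left module ${}_HH$ is $d<\infty$; (AS2) $\operatorname{Ext}_H^i({}_\varepsilon\Bbbk,H)=0$ for $i\neq d$ and $\dim_\Bbbk\operatorname{Ext}_H^d({}_\varepsilon\Bbbk,H)=1$; (AS3) the right-module versions of (AS1) and (AS2) hold, i.e. $H_H$ has injective dimension $d$, $\operatorname{Ext}_{H^{\mathrm{op}}}^i(\Bbbk_\varepsilon,H)=0$ for $i\ne d$ and $\dim_\Bbbk\operatorname{Ext}_{H^{\mathrm{op}}}^d(\Bbbk_\varepsilon,H)=1$. *)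

(* Defs.v *)
From HB Require Import structures.
From mathcomp Require Import all_boot all_algebra.
From mathcomp Require Import boolp functions freeg.

Set Implicit Arguments.
Unset Strict Implicit.
Unset Printing Implicit Defensive.

Import GRing.Theory.
Local Open Scope ring_scope.
Local Open Scope quotient_scope.

(* A left R-module is an [lmodType R]; a right R-module is an
   [lmodType R^c], where R^c is the opposite ring. *)

(** * Submodules, quotients, kernels *)

Section SubmodOf.
Variables (R : pzRingType) (V : lmodType R) (S : V -> bool).
Hypothesis Scl : submod_closed S.

Definition submod_of : submodClosed V :=
  HB.pack S (GRing.isSubmodClosed.Build R V S (GRing.submod_closed_semi Scl)).

Lemma mem_submod_of x : (x \in submod_of) = S x.
Proof. by []. Qed.

End SubmodOf.

Section Span.
Variables (R : pzRingType) (V : lmodType R) (X : V -> Prop).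

Definition span_pred : V -> bool :=
  fun x => `[< forall S : submodClosed V, (forall y, X y -> y \in S) -> x \in S >].

Lemma span_closed : submod_closed span_pred.
Proof.
split=> [|a x y /asboolP xX /asboolP yX].
  by apply/asboolP => S _; apply: rpred0.
apply/asboolP => S XS; apply: rpredD; last exact: yX.
by apply: rpredZ; apply: xX.
Qed.

Definition span : submodClosed V := submod_of span_closed.

Lemma mem_span x : X x -> x \in span.
Proof. by move=> Xx; apply/asboolP => S; apply. Qed.

Lemma span_min (S : submodClosed V) x :
  (forall y, X y -> y \in S) -> x \in span -> x \in S.
Proof. by move=> XS /asboolP; apply. Qed.

End Span.

Section Submodule.
Variables (R : pzRingType) (V : lmodType R) (S : submodClosed V).

Definition submodule := {x : V | x \in S}.

HB.instance Definition _ := SubChoice.on submodule.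
HB.instance Definition _ := [SubChoice_isSubLmodule of submodule by <:].

End Submodule.

Section QuotientModule.
Variables (R : pzRingType) (V : lmodType R) (S : submodClosed V).

(* over a ring, [submodClosed V] does not inherit from [zmodClosed V] *)
Definition submod_zmod : zmodClosed V :=
  HB.pack (S : {pred V}) (GRing.isZmodClosed.Build V (S : {pred V})
                             (GRing.submod_closedB (submodClosedP S))).

Definition quotmod := Quotient.quot submod_zmod.

HB.instance Definition _ := GRing.Zmodule.on quotmod.

Definition quotmod_pi (x : V) : quotmod := \pi_(Quotient.quot submod_zmod) x.

Lemma quotmod_piP x y : reflect (quotmod_pi x = quotmod_pi y) (x - y \in S).
Proof.
change (x - y \in S) with (x - y \in submod_zmod).
by rewrite Quotient.idealrBE; apply: eqP.
Qed.

Lemma quotmod_repr (u : quotmod) : quotmod_pi (repr u) = u.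
Proof. exact: reprK. Qed.

Lemma quotmod_piD x y : quotmod_pi (x + y) = quotmod_pi x + quotmod_pi y.
Proof. exact: Quotient.pi_add. Qed.

Definition quotmod_scale (a : R) (u : quotmod) : quotmod :=
  quotmod_pi (a *: repr u).

Lemma quotmod_scale_pi a x :
  quotmod_scale a (quotmod_pi x) = quotmod_pi (a *: x).
Proof.
apply/quotmod_piP; rewrite -scalerBr; apply: rpredZ.
by apply/quotmod_piP; rewrite quotmod_repr.
Qed.

Lemma quotmod_scaleA a b u :
  quotmod_scale a (quotmod_scale b u) = quotmod_scale (a * b) u.
Proof. by rewrite -(quotmod_repr u) !quotmod_scale_pi scalerA. Qed.

Lemma quotmod_scale1 : left_id 1 quotmod_scale.
Proof. by move=> u; rewrite -(quotmod_repr u) quotmod_scale_pi scale1r. Qed.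

Lemma quotmod_scaleDr : right_distributive quotmod_scale +%R.
Proof.
move=> a u v; rewrite -(quotmod_repr u) -(quotmod_repr v) -quotmod_piD.
by rewrite !quotmod_scale_pi scalerDr quotmod_piD.
Qed.

Lemma quotmod_scaleDl u : {morph quotmod_scale^~ u : a b / a + b}.
Proof.
move=> a b; rewrite -(quotmod_repr u).
by rewrite !quotmod_scale_pi scalerDl quotmod_piD.
Qed.

HB.instance Definition _ := GRing.Zmodule_isLmodule.Build R quotmod
  quotmod_scaleA quotmod_scale1 quotmod_scaleDr quotmod_scaleDl.

Lemma quotmod_pi_linear : linear quotmod_pi.
Proof. by move=> a x y; rewrite quotmod_piD -quotmod_scale_pi. Qed.

HB.instance Definition _ :=
  GRing.isLinear.Build R V quotmod *:%R quotmod_pi quotmod_pi_linear.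

End QuotientModule.

Section Kernel.
Variables (R : pzRingType) (U V : lmodType R) (f : {linear U -> V}).

Definition kernel_pred : U -> bool := fun x => f x == 0.

Lemma kernel_closed : submod_closed kernel_pred.
Proof.
split=> [|a x y /eqP fx /eqP fy]; apply/eqP; first exact: linear0.
by rewrite linearP fx fy scaler0 addr0.
Qed.

Definition kernel : submodClosed U := submod_of kernel_closed.

End Kernel.

(** * Noetherian rings, injective dimension *)

Definition left_noetherian (R : nzRingType) : Prop :=
  forall I : nat -> submodClosed R^o,
    (forall n, {subset I n <= I n.+1}) ->
    exists n, forall m, (n <= m)%N -> I m =i I n.

Definition noetherian (R : nzRingType) : Prop :=
  left_noetherian R /\ left_noetherian R^c.

Section InjectiveDimension.
Variable R : nzRingType.

Definition injective_module (Q : lmodType R) : Prop :=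
  forall (A B : lmodType R) (i : {linear A -> B}) (f : {linear A -> Q}),
    injective i -> exists g : {linear B -> Q}, forall x, g (i x) = f x.

(* there is an injective resolution 0 -> N -> I 0 -> ... -> I n -> 0 *)
Definition injdim_le (N : lmodType R) (n : nat) : Prop :=
  exists (I : nat -> lmodType R) (eta : {linear N -> I 0%N})
         (d : forall m, {linear I m -> I m.+1}),
  [/\ forall m, injective_module (I m),
      injective eta,
      forall x, d 0%N x = 0 <-> exists y, x = eta y,
      forall m x, d m.+1 x = 0 <-> exists y, x = d m y
    & forall m, (n < m)%N -> forall x : I m, x = 0].

Definition injdim_eq (N : lmodType R) (n : nat) : Prop :=
  injdim_le N n /\ forall m, injdim_le N m -> (n <= m)%N.

End InjectiveDimension.

(** * Free modules and the canonical free resolution *)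

Section FreeLift.
Variables (R : nzRingType) (K : choiceType) (V : lmodType R) (f : K -> V).

Lemma fglift_linear : linear (fglift f).
Proof.
have fB := lift_is_additive f.
have f0 : fglift f 0 = 0 by rewrite -(subrr 0) fB subrr.
have fD x y : fglift f (x + y) = fglift f x + fglift f y.
  by rewrite -[y in LHS]opprK -[- y]add0r !fB f0 add0r opprK.
move=> a x y; rewrite fD; congr (_ + _).
rewrite -(freeg_sumE x); elim: (dom x) => [|z s IHs].
  by rewrite !big_nil scaler0 f0 scaler0.
rewrite !big_cons scalerDr !fD IHs scalerDr; congr (_ + _).
suff -> : a *: << coeff z x *g z >> = << a * coeff z x *g z >> :> {freeg K / R}.
  by rewrite !liftU scalerA.
by apply/eqP/freeg_eqP => y'; rewrite coeffZ !coeffU mulrA.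
Qed.

End FreeLift.

Section FreeCover.
Variables (R : nzRingType) (V : lmodType R).

(* the free module on the set underlying V, and its canonical surjection to V *)
Definition free_on : lmodType R := {freeg V / R}.

Definition free_cover : free_on -> V := fglift (@id V).

HB.instance Definition _ := GRing.isLinear.Build R free_on V *:%R free_cover
  (fglift_linear (@id V)).

Definition syz : lmodType R := submodule (kernel free_cover).

Lemma free_cover_surj (x : V) : exists y, free_cover y = x.
Proof. by exists << x >>; rewrite /free_cover liftU scale1r. Qed.

End FreeCover.

Section FreeDiff.
Variables (R : nzRingType) (V : lmodType R).

Definition free_diff : free_on (syz V) -> free_on V :=
  fun x => val (free_cover x).

Lemma free_diff_linear : linear free_diff.
Proof. by move=> a x y; rewrite /free_diff !linearP. Qed.

HB.instance Definition _ :=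
  GRing.isLinear.Build R (free_on (syz V)) (free_on V) *:%R free_diff
    free_diff_linear.

Lemma free_diff_exact (x : free_on V) :
  free_cover x = 0 <-> exists y, x = free_diff y.
Proof.
split=> [x0 | [y ->]]; last exact/eqP/(valP (free_cover y)).
have kx : x \in kernel (@free_cover R V) by apply/eqP.
have [y yx] := free_cover_surj (Sub x kx : syz V).
by exists y; rewrite /free_diff yx.
Qed.

Lemma free_diff_eq0 x : free_diff x = 0 <-> free_cover x = 0.
Proof.
rewrite /free_diff; split=> [x0|->]; last exact: raddf0.
by apply: val_inj; rewrite x0 raddf0.
Qed.

End FreeDiff.

Section FreeResolution.
Variables (R : nzRingType) (M : lmodType R).

(* the free resolution ... -> free_res 1 -> free_res 0 -> M -> 0, in which
   free_res n is free on the n-th syzygy of M *)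
Definition free_res (n : nat) : lmodType R := free_on (iter n (@syz R) M).

Definition free_res_diff (n : nat) : {linear free_res n.+1 -> free_res n} :=
  @free_diff R (iter n (@syz R) M).

Lemma free_res_exact0 (x : free_res 0) :
  free_cover x = 0 <-> exists y, x = free_res_diff 0 y.
Proof. exact: free_diff_exact. Qed.

Lemma free_res_exact n (x : free_res n.+1) :
  free_res_diff n x = 0 <-> exists y, x = free_res_diff n.+1 y.
Proof.
by split=> [/free_diff_eq0/free_diff_exact | /free_diff_exact/free_diff_eq0].
Qed.

End FreeResolution.

(** * Ext over a k-algebra, as a k-vector space *)

Section RestrictScalars.
Variables (k : nzRingType) (A : algType k) (N : lmodType A).

Definition restrict : Type := N.

HB.instance Definition _ := GRing.Zmodule.on restrict.

Let scale (c : k) (x : restrict) : restrict := c%:A *: (x : N).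

Let scaleA a b x : scale a (scale b x) = scale (a * b) x.
Proof. by rewrite /scale scalerA -scalerAl mul1r scalerA. Qed.
Let scale1 : left_id 1 scale.
Proof. by move=> x; rewrite /scale !scale1r. Qed.
Let scaleDr : right_distributive scale +%R.
Proof. by move=> a x y; rewrite /scale scalerDr. Qed.
Let scaleDl x : {morph scale^~ x : a b / a + b}.
Proof. by move=> a b; rewrite /scale !scalerDl. Qed.

HB.instance Definition _ := GRing.Zmodule_isLmodule.Build k restrict
  scaleA scale1 scaleDr scaleDl.

End RestrictScalars.

Section Hom.
Variables (k : nzRingType) (A : algType k).
Implicit Types M N : lmodType A.

Definition is_linear M N : (M -> restrict N) -> bool :=
  fun f => `[< linear (f : M -> N) >].

Lemma is_linear_closed M N : submod_closed (@is_linear M N).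
Proof.
split=> [|c f g /asboolP fl /asboolP gl]; apply/asboolP => a x y.
  by rewrite [RHS]addr0; exact: (esym (scaler0 _ _)).
have fE h : (c *: f + h) = (fun z => c%:A *: (f z : N) + h z) by [].
rewrite fE fl gl !scalerDr !scalerA addrACA.
by rewrite -scalerAl mul1r -scalerAr mulr1.
Qed.

(* Hom_A(M, N); its k-structure is (c f)(x) = c f(x) *)
Definition hom M N : lmodType k := submodule (submod_of (@is_linear_closed M N)).

Section Precomposition.
Variables (M M' N : lmodType A) (d : {linear M' -> M}).

Lemma precomp_subproof (f : hom M N) :
  @is_linear M' N (fun x => val f (d x)).
Proof.
case: f => f /= /asboolP fl; apply/asboolP => a x y.
by rewrite linearP fl.
Qed.

Definition precomp (f : hom M N) : hom M' N := Sub _ (precomp_subproof f).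

Lemma precomp_linear : linear precomp.
Proof. by move=> c f g; apply: val_inj. Qed.

HB.instance Definition _ :=
  GRing.isLinear.Build k (hom M N) (hom M' N) *:%R precomp precomp_linear.

End Precomposition.
End Hom.

Section Ext.
Variables (k : nzRingType) (A : algType k).

Section Cohomology.
(* the n-th cohomology of the complex Hom_A(P 0, N) -> Hom_A(P 1, N) -> ... *)
Variables (P : nat -> lmodType A) (d : forall n, {linear P n.+1 -> P n}).
Variables (N : lmodType A) (n : nat).

Definition cocycle : lmodType k :=
  submodule (kernel (precomp (N := N) (d n))).

Definition is_coboundary : cocycle -> bool :=
  match n as n0 return submodule (kernel (precomp (N := N) (d n0))) -> bool with
  | 0%N => fun f => f == 0
  | m.+1 => fun f => `[< exists g : hom (P m) N, val f = precomp (d m) g >]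
  end.

Lemma is_coboundary_closed : submod_closed is_coboundary.
Proof.
rewrite /is_coboundary /cocycle; case: n => [|m].
  split=> [|c f g /eqP -> /eqP ->]; apply/eqP => //.
  by rewrite scaler0 addr0.
split=> [|c f g /asboolP [f' ff'] /asboolP [g' gg']]; apply/asboolP.
  by exists 0; symmetry; apply: linear0.
by exists (c *: f' + g'); rewrite [RHS](linearP (precomp (d m))) /= -ff' -gg'.
Qed.

Definition cohomology : lmodType k := quotmod (submod_of is_coboundary_closed).

End Cohomology.

Definition Ext (n : nat) (M N : lmodType A) : lmodType k :=
  cohomology (free_res_diff M) N n.

End Ext.

(** * Tensor products over a field *)

Section Tensor.
Variable k : fieldType.

Section Def.
Variables V W : lmodType k.

Local Notation F := {freeg (V * W)%type / k}.

Inductive tensor_rel : F -> Prop :=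
| TensorDl v v' w : tensor_rel (<< (v + v', w) >> - << (v, w) >> - << (v', w) >>)
| TensorDr v w w' : tensor_rel (<< (v, w + w') >> - << (v, w) >> - << (v, w') >>)
| TensorZl c v w : tensor_rel (<< (c *: v, w) >> - c *: << (v, w) >>)
| TensorZr c v w : tensor_rel (<< (v, c *: w) >> - c *: << (v, w) >>).

Definition tensor : lmodType k := quotmod (span tensor_rel).

Definition tens (v : V) (w : W) : tensor := quotmod_pi _ << (v, w) >>.

(* The linear map induced by f when f is bilinear, see [tensor_liftE] and
   [tensor_lift_linear]; meaningless otherwise. *)
Definition tensor_lift (U : lmodType k) (f : V -> W -> U) (t : tensor) : U :=
  fglift (fun p : V * W => f p.1 p.2) (repr t).

End Def.

Local Notation bilin f := (bilinear_for *:%R *:%R f).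
Implicit Types U V W : lmodType k.

Lemma tens_bilinear V W : bilin (@tens V W).
Proof.
have piP (x y : {freeg (V * W)%type / k}) : tensor_rel (x - y) ->
    quotmod_pi (span (@tensor_rel V W)) x = quotmod_pi (span (@tensor_rel V W)) y.
  by move=> r; apply/quotmod_piP/mem_span.
have tDl v v' w : tens (v + v') w = tens v w + tens v' w :> tensor V W.
  rewrite /tens -linearD; apply: piP; rewrite opprD addrA; exact: TensorDl.
have tDr v w w' : tens v (w + w') = tens v w + tens v w' :> tensor V W.
  rewrite /tens -linearD; apply: piP; rewrite opprD addrA; exact: TensorDr.
have tZl c v w : tens (c *: v) w = c *: tens v w :> tensor V W.
  rewrite /tens -linearZ; apply: piP; exact: TensorZl.
have tZr c v w : tens v (c *: w) = c *: tens v w :> tensor V W.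
  rewrite /tens -linearZ; apply: piP; exact: TensorZr.
by split=> [w|v] c x y; rewrite ?tDl ?tDr ?tZl ?tZr.
Qed.

Lemma tensor_lift_pi V W U (f : V -> W -> U) (x : {freeg (V * W)%type / k}) :
  bilin f ->
  tensor_lift f (quotmod_pi _ x) = fglift (fun p : V * W => f p.1 p.2) x.
Proof.
case=> fl fr; set F := fglift _.
have Flin : linear F := fglift_linear _.
pose Fm := GRing.isLinear.Build _ _ _ _ F Flin.
pose Fl : {linear {freeg (V * W)%type / k} -> U} := HB.pack F Fm.
have FU v w : F << (v, w) >> = f v w by rewrite /F liftU scale1r.
have fDl v v' w : f (v + v') w = f v w + f v' w.
  by have := fl w 1 v v'; rewrite /= !scale1r.
have fDr v w w' : f v (w + w') = f v w + f v w'.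
  by have := fr v 1 w w'; rewrite /= !scale1r.
have f0l w : f 0 w = 0 by apply: (addIr (f 0 w)); rewrite -fDl !add0r.
have f0r v : f v 0 = 0 by apply: (addIr (f v 0)); rewrite -fDr !add0r.
have fZl c v w : f (c *: v) w = c *: f v w.
  by have := fl w c v 0; rewrite /= !addr0 f0l addr0.
have fZr c v w : f v (c *: w) = c *: f v w.
  by have := fr v c w 0; rewrite /= !addr0 f0r addr0.
have : x - repr (quotmod_pi (span (@tensor_rel V W)) x) \in kernel Fl.
  apply: (span_min (X := @tensor_rel V W)); last first.
    by apply/quotmod_piP; rewrite quotmod_repr.
  move=> _ [v v' w|v w w'|c v w|c v w]; apply/eqP; rewrite linearB.
  - by rewrite linearB /= !FU fDl addrAC addrK subrr.
  - by rewrite linearB /= !FU fDr addrAC addrK subrr.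
  - by rewrite linearZ /= !FU fZl subrr.
  - by rewrite linearZ /= !FU fZr subrr.
rewrite /tensor_lift -/F => /eqP.
by rewrite linearB => /eqP; rewrite subr_eq0 => /eqP e; apply: esym e.
Qed.

Lemma tensor_liftE V W U (f : V -> W -> U) v w :
  bilin f -> tensor_lift f (tens v w) = f v w.
Proof. by move=> fb; rewrite tensor_lift_pi // liftU scale1r. Qed.

Lemma tensor_lift_linear V W U (f : V -> W -> U) :
  bilin f -> linear (tensor_lift f).
Proof.
move=> fb c s t; rewrite -(quotmod_repr s) -(quotmod_repr t) -linearP.
by rewrite !tensor_lift_pi // fglift_linear.
Qed.

Lemma bilinP U V W (f : V -> W -> U) :
  (forall w, linear (f^~ w)) -> (forall v, linear (f v)) -> bilin f.
Proof. by split. Qed.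

Lemma tensPl V W c v v' w :
  tens (c *: v + v') w = c *: tens v w + tens v' w :> tensor V W.
Proof. exact: (tens_bilinear V W).1. Qed.

Lemma tensPr V W c v w w' :
  tens v (c *: w + w') = c *: tens v w + tens v w' :> tensor V W.
Proof. exact: (tens_bilinear V W).2. Qed.

Lemma tensor_lift_fun V W U c (f g : V -> W -> U) t :
  tensor_lift (fun v w => c *: f v w + g v w) t =
  c *: tensor_lift f t + tensor_lift g t.
Proof.
rewrite /tensor_lift -(Freeg_enum (repr t)) !fglift_Freeg /prelift.
rewrite scaler_sumr -big_split /=; apply: eq_bigr => i _.
by rewrite scalerDr !scalerA mulrC.
Qed.

Lemma eq_tensor_lift V W U (f g : V -> W -> U) t :
  (forall v w, f v w = g v w) -> tensor_lift f t = tensor_lift g t.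
Proof. by move=> fg; congr (tensor_lift _ t); do 2!apply: funext => ?. Qed.

Definition tensor_map V V' W W' (f : V -> V') (g : W -> W') :
    tensor V W -> tensor V' W' :=
  tensor_lift (fun v w => tens (f v) (g w)).

Lemma tensor_mapE V V' W W' (f : {linear V -> V'}) (g : {linear W -> W'}) v w :
  tensor_map f g (tens v w) = tens (f v) (g w).
Proof.
by apply: tensor_liftE; apply: bilinP => ? ? ? ?;
  rewrite linearP ?tensPl ?tensPr.
Qed.

Definition tensor_assoc U V W :
    tensor (tensor U V) W -> tensor U (tensor V W) :=
  tensor_lift (fun t w => tensor_lift (fun u v => tens u (tens v w)) t).

Lemma tensor_assocE U V W (u : U) (v : V) (w : W) :
  tensor_assoc (tens (tens u v) w) = tens u (tens v w).
Proof.
have bw (w' : W) : bilin (fun (u : U) (v : V) => tens u (tens v w')).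
  by apply: bilinP => ? ? ? ?; rewrite ?tensPl ?tensPr.
rewrite /tensor_assoc tensor_liftE; first by rewrite tensor_liftE.
apply: bilinP => [w'|t]; first exact: tensor_lift_linear (bw w').
move=> c w1 w2; rewrite -tensor_lift_fun.
by apply: eq_tensor_lift => u' v'; rewrite !tensPr.
Qed.

(* multiplication of the algebra A (x) B: (a (x) b)(a' (x) b') = aa' (x) bb' *)
Definition tensor_mul (A B : algType k) (s t : tensor A B) : tensor A B :=
  tensor_lift (fun a b => tensor_lift (fun a' b' => tens (a * a') (b * b')) t) s.

Lemma tensor_mulE (A B : algType k) (a a' : A) (b b' : B) :
  tensor_mul (tens a b) (tens a' b') = tens (a * a') (b * b').
Proof.
have bm (x : A) (y : B) : bilin (fun x' y' => tens (x * x') (y * y')).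
  by apply: bilinP => ? ? ? ?; rewrite mulrDr -scalerAr ?tensPl ?tensPr.
rewrite /tensor_mul tensor_liftE; first by rewrite tensor_liftE.
apply: bilinP => [y|x] c z z'; rewrite -tensor_lift_fun;
  by apply: eq_tensor_lift => ? ?; rewrite mulrDl -scalerAl ?tensPl ?tensPr.
Qed.

End Tensor.

(** * Hopf algebras *)

(* all the functions lifted below are bilinear *)
Record hopfAlgType (k : fieldType) := HopfAlgType {
  hopf_sort :> algType k;
  comul : {linear hopf_sort -> tensor hopf_sort hopf_sort};
  counit : {lrmorphism hopf_sort -> k^o};
  antipode : {linear hopf_sort -> hopf_sort};
  comul1 : comul 1 = tens 1 1;
  comulM : forall x y, comul (x * y) = tensor_mul (comul x) (comul y);
  comulA : forall x, tensor_assoc (tensor_map comul id (comul x)) =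
                     tensor_map id comul (comul x);
  counitl : forall x, tensor_lift (fun a b => counit a *: b) (comul x) = x;
  counitr : forall x, tensor_lift (fun a b => counit b *: a) (comul x) = x;
  antipodel : forall x,
    tensor_lift (fun a b => antipode a * b) (comul x) = (counit x)%:A;
  antipoder : forall x,
    tensor_lift (fun a b => a * antipode b) (comul x) = (counit x)%:A
}.

(** * AS-Gorenstein Hopf algebras *)

(* If A is a k-algebra then so is A^c, with the same scalar multiplication *)
Section ConverseAlgebra.
Variables (k : pzRingType) (A : algType k).

HB.instance Definition _ := GRing.Lmodule.copy A^c A.
HB.instance Definition _ := GRing.Lmodule_isLalgebra.Build k A^c
  (fun c (x y : A) => scalerAr c y x).
HB.instance Definition _ := GRing.Lalgebra_isAlgebra.Build k A^c
  (fun c (x y : A) => scalerAl c y x).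

End ConverseAlgebra.

(* k as an R-module through the ring morphism eps : R -> k *)
Definition trivial_module (k : fieldType) (R : nzRingType)
  (eps : {rmorphism R -> k}) : Type := k.

Section TrivialModule.
Variables (k : fieldType) (R : nzRingType) (eps : {rmorphism R -> k}).

Local Notation trivial_module := (trivial_module eps).

HB.instance Definition _ := GRing.Zmodule.copy trivial_module k.

Let scale (r : R) (x : trivial_module) : trivial_module := eps r * (x : k).

Let scaleA a b x : scale a (scale b x) = scale (a * b) x.
Proof. by rewrite /scale rmorphM mulrA. Qed.
Let scale1 : left_id 1 scale.
Proof. by move=> x; rewrite /scale rmorph1 mul1r. Qed.
Let scaleDr : right_distributive scale +%R.
Proof. by move=> a x y; apply: mulrDr. Qed.
Let scaleDl x : {morph scale^~ x : a b / a + b}.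
Proof. by move=> a b; rewrite /scale rmorphD mulrDl. Qed.

HB.instance Definition _ := GRing.Zmodule_isLmodule.Build R trivial_module
  scaleA scale1 scaleDr scaleDl.

End TrivialModule.

Definition has_dim (k : fieldType) (V : lmodType k) (n : nat) : Prop :=
  exists e : 'I_n -> V,
    forall v, exists! c : 'rV[k]_n, v = \sum_(i < n) c 0 i *: e i.

(* the conditions on left A-modules, for an algebra A with augmentation eps *)
Definition AS_condition (k : fieldType) (A : algType k)
    (eps : {rmorphism A -> k}) (d : nat) : Prop :=
  [/\ injdim_eq (A^o : lmodType A) d,
      forall i, i != d -> forall x : Ext i (trivial_module eps) A^o, x = 0
    & has_dim (Ext d (trivial_module eps) A^o) 1].

Section ASGorenstein.
Variables (k : fieldType) (H : hopfAlgType k).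

Definition counitc : H^c -> k := counit H.

Lemma counitc_zmod : zmod_morphism counitc.
Proof. by move=> x y; apply: raddfB. Qed.

Lemma counitc_monoid : monoid_morphism counitc.
Proof.
by split=> [|x y]; [apply: rmorph1 | rewrite mulrC; apply: (rmorphM (counit H))].
Qed.

HB.instance Definition _ := GRing.isZmodMorphism.Build H^c k counitc counitc_zmod.
HB.instance Definition _ :=
  GRing.isMonoidMorphism.Build H^c k counitc counitc_monoid.

(* same d on both sides; right H-modules are left H^c-modules *)
Definition AS_Gorenstein : Prop :=
  exists2 d : nat, AS_condition (counit H : {rmorphism H -> k}) d
                 & AS_condition (counitc : {rmorphism H^c -> k}) d.

End ASGorenstein.

(* Main.v *)
(* Let d be the common dimension, e a generator of Ext^d(k, H) as a left module,
   and xi : H -> k the character through which H acts on e on the right. Put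
   nu = S^2 o w with w the winding map s |-> xi(s_1) s_2, which is bijective with
   inverse s |-> xi(S s_1) s_2; let nu' be the analogous map for right modules.

   Give H (x) H its outer bimodule structure. The left adjoint module
   a . m = a_1 m S(a_2) is isomorphic to H (x) H with H acting on the first factor
   only, so, k having a resolution by finitely generated free modules,
   Ext^d(k, ad_l (H (x) H)) = k e (x) H; on it the bimodule endomorphism
   x (x) y |-> x s (x) t y becomes y |-> t y nu(s). In the same way the Ext^d of
   right modules from k to the right adjoint module is H with action
   y |-> nu'(t) y s. Both groups are the Hochschild cohomology of H (x) H: the
   invariants of either adjoint module are the central elements, and bimodules
   coinduced from k are acyclic for both, so dimension shifting identifies them,
   naturally in the bimodule.

   The result is a bijection F : H -> H with F(t y nu(s)) = nu'(t) F(y) s. Hence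
   u = F(1) satisfies F(t) = nu'(t) u, so it has a left inverse, so it is a unit
   as H is noetherian, and F(nu(s)) = u s makes nu, S^2 and finally S bijective. *)

(* Since [S] is not yet known to be injective or surjective, every isomorphism is written with [S]
   and [S^2] alone. The untwisting x (x) y |-> x_1 (x) y S(x_2) has inverse x (x) y |-> x_1 (x) y
   S^2(x_2); this is the origin of the S^2 in nu.

   The tensor factor H that is pulled out of Ext is infinite-dimensional, so finiteness is
   essential, yet Ext is defined by a resolution that is free on whole underlying sets. That
   resolution is kept: every cocycle on it is cohomologous to one that factors through a finitely
   generated module, and this does what a finitely generated resolution would do.

   Two sides are needed because each one twists a different variable: nu falls on s on the left, nu'
   on t on the right. The comparison trades the unknown factor nu(s) for plain multiplication by s,
   and the twist nu'(t) that it brings in is harmless, because t = 1 suffices where s varies.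

   No Ext over the enveloping algebra appears: a Hochschild class is a central element of an
   iterated cosyzygy, up to those that lift to a central element of a coinduced bimodule. *)
From HB Require Import structures.
From mathcomp Require Import all_boot all_algebra.
From mathcomp Require Import boolp classical_sets functions freeg.
Require Import Defs.

Set Implicit Arguments.
Unset Strict Implicit.
Unset Printing Implicit Defensive.

Import GRing.Theory.
Local Open Scope ring_scope.
Local Obligation Tactic := idtac.

(** * Cocycles as maps out of syzygies *)

Definition mklin (R : pzRingType) (U V : lmodType R) (f : U -> V)
  (fl : linear f) : {linear U -> V} :=
  HB.pack f (GRing.isLinear.Build R U V *:%R f fl).

Section FreeModules.
Variable R : nzRingType.
Implicit Types V W X : lmodType R.

Lemma freeg_lin_sum (K : choiceType) V (g : {linear {freeg K / R} -> V})
    (u : {freeg K / R}) :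
  g u = \sum_(x <- dom u) coeff x u *: g << x >>.
Proof.
rewrite -[in LHS](freeg_sumE u) linear_sum; apply: eq_bigr => x _.
rewrite -linearZ; congr (g _).
by apply/eqP/freeg_eqP => y; rewrite coeffZ !coeffU mul1r.
Qed.

Lemma eq_freeg_lin (K : choiceType) V (g h : {linear {freeg K / R} -> V}) :
  (forall x, g << x >> = h << x >>) -> g =1 h.
Proof.
move=> gh u; rewrite !freeg_lin_sum.
by apply: eq_bigr => x _; rewrite gh.
Qed.

Lemma free_extend X V (f : X -> V) :
  exists g : {linear free_on X -> V}, forall x, g << x >> = f x.
Proof.
exists (mklin (fglift_linear f) : {linear free_on X -> V}) => x.
by rewrite /= /mklin /= liftU scale1r.
Qed.

Lemma free_lift X V W (p : {linear V -> W}) (g : {linear free_on X -> W}) :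
  (forall w, exists v, p v = w) ->
  exists h : {linear free_on X -> V}, forall x, p (h x) = g x.
Proof.
move=> psurj.
have [s sP] := choice (fun x : X => psurj (g << x >>)).
have [h hP] := free_extend s.
exists h; apply: (eq_freeg_lin (g := p \o h : {linear _ -> _})) => x /=.
by rewrite hP sP.
Qed.

Definition syz_val X : {linear syz X -> free_on X} :=
  mklin (fun a (x y : syz X) => erefl : val (a *: x + y) = a *: val x + val y).

Lemma free_cover_syz X (x : syz X) : free_cover (syz_val X x) = 0.
Proof. exact/eqP/(valP x). Qed.

Lemma syz_valP X (u : free_on X) :
  free_cover u = 0 -> exists x, syz_val X x = u.
Proof.
move=> u0; have ku : u \in kernel (@free_cover R X) by apply/eqP.
by exists (Sub u ku).
Qed.

Lemma syz_val_inj X : injective (syz_val X).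
Proof. exact: val_inj. Qed.

Lemma free_coverU X (x : X) : free_cover << x >> = x.
Proof. by rewrite /free_cover liftU scale1r. Qed.

Lemma free_descend X V (h : {linear free_on X -> V}) :
  (forall x, h (syz_val X x) = 0) ->
  exists f : {linear X -> V}, forall u, f (free_cover u) = h u.
Proof.
move=> h0.
have hE u v : free_cover u = free_cover v -> h u = h v.
  move=> uv; apply/eqP; rewrite -subr_eq0 -linearB; apply/eqP.
  have [|x <-] := @syz_valP X (u - v); last exact: h0.
  by rewrite linearB /= uv subrr.
have fl : linear (fun x : X => h << x >>).
  move=> a x y; rewrite -linearP; apply: hE.
  by rewrite linearP /= !free_coverU.
by exists (mklin fl) => u; rewrite /mklin /=; apply: hE; rewrite free_coverU.
Qed.

(** Ext^n(T, N) is the space of linear maps from the n-th syzygy to N modulo those that extend to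
    the free module containing it; in degree 0 only zero is trivial. The argument is a bare function
    so that sums and differences need no packed linearity proof. *)
Definition is_cob (T N : lmodType R) n : (iter n (@syz R) T -> N) -> Prop :=
  match n with
  | 0%N => fun f => forall x, f x = 0
  | m.+1 => fun f =>
      exists g : {linear free_on (iter m (@syz R) T) -> N},
        forall x, f x = g (syz_val _ x)
  end.
Arguments is_cob : clear implicits.

Lemma cob_comp (T N N' : lmodType R) n (f : iter n (@syz R) T -> N)
    (a : {linear N -> N'}) :
  is_cob T N n f -> is_cob T N' n (fun x => a (f x)).
Proof.
case: n f => [|n] f /= => [f0 x | [g gP]]; first by rewrite f0 linear0.
by exists (a \o g : {linear _ -> _}) => x; rewrite gP.
Qed.

Lemma cob_ext (T N : lmodType R) n (f g : iter n (@syz R) T -> N) :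
  f =1 g -> is_cob T N n f -> is_cob T N n g.
Proof. by move=> /funext ->. Qed.

Lemma cob0 (T N : lmodType R) n : is_cob T N n (fun=> 0).
Proof. by case: n => [|n] //=; exists (\0 : {linear _ -> _}). Qed.

Lemma cobD (T N : lmodType R) n (f g : iter n (@syz R) T -> N) :
  is_cob T N n f -> is_cob T N n g -> is_cob T N n (fun x => f x + g x).
Proof.
case: n f g => [|n] f g /= => [f0 g0 x | [f' fP] [g' gP]].
  by rewrite f0 g0 addr0.
by exists (f' \+ g' : {linear _ -> _}) => x; rewrite fP gP.
Qed.

Lemma cobN (T N : lmodType R) n (f : iter n (@syz R) T -> N) :
  is_cob T N n f -> is_cob T N n (fun x => - f x).
Proof.
case: n f => [|n] f /= => [f0 x | [f' fP]]; first by rewrite f0 oppr0.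
by exists (\- f' : {linear _ -> _}) => x; rewrite fP.
Qed.

Lemma cobB (T N : lmodType R) n (f g : iter n (@syz R) T -> N) :
  is_cob T N n f -> is_cob T N n g -> is_cob T N n (fun x => f x - g x).
Proof. by move=> cf cg; apply: cobD => //; apply: cobN. Qed.

Lemma cob_sum (T N : lmodType R) n (I : Type) (s : seq I)
    (f : I -> iter n (@syz R) T -> N) :
  (forall i, is_cob T N n (f i)) ->
  is_cob T N n (fun x => \sum_(i <- s) f i x).
Proof.
move=> cf; elim: s => [|i s IHs].
  by apply: (cob_ext _ (cob0 T N n)) => x; rewrite big_nil.
by apply: (cob_ext _ (cobD (cf i) IHs)) => x; rewrite big_cons.
Qed.

End FreeModules.
Arguments is_cob {R T N} n _.

(** * Finitely generated modules over a noetherian ring *)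

Section Generators.
Variable R : nzRingType.
Implicit Types V W : lmodType R.

Fixpoint gen V (s : seq V) (x : V) : Prop :=
  if s is v :: s' then exists a : R, gen s' (x - a *: v) else x = 0.

Lemma gen0 V (s : seq V) : gen s 0.
Proof. by elim: s => [|v s IHs] //=; exists 0; rewrite scale0r subr0. Qed.

Lemma gen_lin V (s : seq V) a x y : gen s x -> gen s y -> gen s (a *: x + y).
Proof.
elim: s x y => [|v s IHs] x y /= => [-> ->|[b xb] [c yc]].
  by rewrite scaler0 addr0.
exists (a * b + c); suff -> : a *: x + y - (a * b + c) *: v =
  a *: (x - b *: v) + (y - c *: v) by apply: IHs.
by rewrite scalerDl scalerBr scalerA opprD addrACA.
Qed.

Lemma gen_submod V (s : seq V) : submod_closed (fun x => `[< gen s x >]).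
Proof.
split=> [|a x y /asboolP gx /asboolP gy]; apply/asboolP; first exact: gen0.
exact: gen_lin.
Qed.

Lemma gen_cat V (s t : seq V) x y : gen s x -> gen t y -> gen (s ++ t) (x + y).
Proof.
elim: s x => [|v s IHs] x /= => [-> | [a xa] ty]; first by rewrite add0r.
by exists a; rewrite addrAC; apply: IHs.
Qed.

Lemma gen_sub V (S : submodClosed V) (s : seq V) x :
  {subset s <= S} -> gen s x -> x \in S.
Proof.
elim: s x => [|v s IHs] x sS /= => [->|[a xa]]; first exact: rpred0.
rewrite -[x](subrK (a *: v)); apply: rpredD.
  by apply: IHs xa => y ys; apply: sS; rewrite inE ys orbT.
by apply: rpredZ; apply: sS; rewrite inE eqxx.
Qed.

Lemma gen_lift V W (f : {linear V -> W}) (s : seq V) y :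
  gen (map f s) y -> exists2 x, gen s x & f x = y.
Proof.
elim: s y => [|v s IHs] y /= => [->|[a /IHs [x gx fx]]].
  by exists 0; rewrite ?linear0.
exists (x + a *: v); first by exists a; rewrite addrK.
by rewrite linearD linearZ /= fx subrK.
Qed.

Lemma gen_map_inj V W (f : {linear V -> W}) (s : seq V) x :
  injective f -> gen (map f s) (f x) -> gen s x.
Proof. by move=> fi /gen_lift [x' gx' /fi <-]. Qed.

Lemma gen_sum V (s : seq V) x : gen s x ->
  exists c : nat -> R, x = \sum_(i < size s) c i *: s`_i.
Proof.
elim: s x => [|v s IHs] x /= => [->|[a /IHs [c xc]]].
  by exists (fun=> 0); rewrite big_ord0.
exists (fun i => if i is j.+1 then c j else a).
by rewrite big_ord_recl /= -xc addrC subrK.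
Qed.

Definition fin_gen V : Prop := exists s : seq V, forall x, gen s x.

Lemma row_comb_linear V (s : seq V) :
  linear (fun c : 'rV[R]_(size s) => \sum_(i < size s) c 0 i *: s`_i).
Proof.
move=> a x y; rewrite scaler_sumr -big_split /=; apply: eq_bigr => i _.
by rewrite !mxE scalerDl scalerA.
Qed.

Lemma fin_gen_cover V : fin_gen V ->
  exists r (f : {linear 'rV[R]_r -> V}), forall x, exists c, f c = x.
Proof.
case=> s sV; exists (size s), (mklin (@row_comb_linear V s)) => x.
have [c ->] := gen_sum (sV x); exists (\row_i c i).
by rewrite /mklin /=; apply: eq_bigr => i _; rewrite mxE.
Qed.

Lemma row_lift r V W (p : {linear V -> W}) (g : {linear 'rV[R]_r -> W}) :
  (forall w, exists v, p v = w) ->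
  exists h : {linear 'rV[R]_r -> V}, forall c, p (h c) = g c.
Proof.
move=> psurj.
have [s sP] := choice (fun i : 'I_r => psurj (g (delta_mx 0 i))).
have hl : linear (fun c : 'rV[R]_r => \sum_(i < r) c 0 i *: s i).
  move=> a x y; rewrite scaler_sumr -big_split /=; apply: eq_bigr => i _.
  by rewrite !mxE scalerDl scalerA.
exists (mklin hl) => c; rewrite /mklin /= linear_sum [in RHS](row_sum_delta c).
rewrite linear_sum; apply: eq_bigr => i _; by rewrite !linearZ /= sP.
Qed.

Hypothesis Rn : left_noetherian R.

(** If no finite list generates I, adjoining again and again an element of I outside the span
    reached so far gives a strictly ascending chain. *)
Lemma ideal_fg (I : submodClosed R^o) :
  exists2 s : seq R^o, {subset s <= I} & forall x, x \in I -> gen s x.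
Proof.
apply: contrapT => noS.
have nx (s : seq R^o) : exists x : R^o,
    {subset s <= I} -> x \in I /\ ~ gen s x.
  (* The value 0 is a dummy for lists that leave I, which never occur among the [s n]. *)
  case: (pselect ({subset s <= I})) => [sI|nsI]; last by exists 0 => /nsI.
  apply: contrapT => nex; apply: noS; exists s => // x xI.
  by apply: contrapT => ng; apply: nex; exists x.
have [next nextP] := choice nx.
pose s n := iter n (fun s => next s :: s) [::].
have sI n : {subset s n <= I}.
  elim: n => [|n IHn] x //=; rewrite inE => /orP [/eqP ->|/IHn //].
  by have [] := nextP _ IHn.
have [|n nP] := Rn (I := fun n => submod_of (gen_submod (s n))).
  move=> n x /asboolP gx; apply/asboolP; exists 0.
  by rewrite scale0r subr0.
have [_ []] := nextP _ (sI n).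
suff : next (s n) \in submod_of (gen_submod (s n)) by move/asboolP.
rewrite -(nP n.+1) //; apply/asboolP; exists 1.
by rewrite scale1r subrr; apply: gen0.
Qed.

(** Descending induction on the number j of leading coordinates required to vanish, with m = r - j.
    The j-th coordinates of the remaining elements of K form a left ideal; subtracting a combination
    of lifts of its generators makes one more coordinate vanish. *)
Lemma row_submod_fg r (K : submodClosed 'rV[R]_r) :
  exists2 s : seq 'rV[R]_r, {subset s <= K} & forall x, x \in K -> gen s x.
Proof.
suff H m j : (j + m = r)%N -> exists2 s : seq 'rV[R]_r, {subset s <= K} &
    forall x, x \in K -> (forall i : 'I_r, (i < j)%N -> x 0 i = 0) -> gen s x.
  by have [s sK sP] := H r 0%N erefl; exists s => // x xK; apply: sP.
elim: m j => [|m IHm] j.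
  rewrite addn0 => ->; exists [::] => // x _ x0 /=.
  by apply/rowP => i; rewrite x0 // mxE.
move=> jm; have [|s sK sP] := IHm j.+1; first by rewrite addSn -addnS.
have jr : (j < r)%N by rewrite -jm -addSnnS leq_addr.
pose j' := Ordinal jr.
pose Kj (x : 'rV[R]_r) := (x \in K) && [forall i : 'I_r, (i < j)%N ==> (x 0 i == 0)].
have KjP x : reflect (x \in K /\ forall i : 'I_r, (i < j)%N -> x 0 i = 0) (Kj x).
  apply: (iffP andP) => -[xK x0]; split=> //.
    by move=> i ij; apply/eqP; move/forallP: x0 => /(_ i); rewrite ij.
  by apply/forallP => i; apply/implyP => /x0 ->.
have Kjs : submod_closed Kj.
  split=> [|a x y /KjP [xK x0] /KjP [yK y0]]; apply/KjP; split.
  - exact: rpred0.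
  - by move=> i _; rewrite mxE.
  - by apply: rpredD => //; apply: rpredZ.
  - by move=> i ij; rewrite !mxE x0 // y0 // mulr0 addr0.
have cl : linear (fun x : 'rV[R]_r => x 0 j' : R^o) by move=> a x y; rewrite !mxE.
pose c : {linear 'rV[R]_r -> R^o} := mklin cl.
have Is : submod_closed (fun b : R^o => `[< exists2 x, Kj x & c x = b >]).
  split=> [|a _ _ /asboolP [x xK <-] /asboolP [y yK <-]]; apply/asboolP.
    by exists 0; [exact: Kjs.1 | rewrite linear0].
  by exists (a *: x + y); [exact: Kjs.2 | rewrite linearP].
have [t tI tP] := ideal_fg (submod_of Is).
have [l lK lt] : exists2 l : seq 'rV[R]_r, {subset l <= submod_of Kjs} & map c l = t.
  elim: t tI {tP} => [|b t IHt] tI; first by exists [::].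
  have [|l lK <-] := IHt; first by move=> y yt; apply: tI; rewrite inE yt orbT.
  have /asboolP [x xK xb] := tI b (mem_head _ _).
  exists (x :: l); last by congr (_ :: _).
  by move=> y; rewrite inE => /orP [/eqP ->|/lK].
exists (l ++ s).
  by move=> y; rewrite mem_cat => /orP [/lK /KjP []|/sK].
move=> x xK x0; have Kx : Kj x by apply/KjP.
have : gen (map c l) (c x) by rewrite lt; apply: tP; apply/asboolP; exists x.
move=> /gen_lift [y gy yx].
have /KjP [yK y0] := gen_sub lK gy.
rewrite -[x](subrK y) addrC; apply: gen_cat => //; apply: sP.
  exact: (GRing.submod_closedB (submodClosedP K)).2.
move=> i; rewrite ltnS leq_eqVlt => /orP [/eqP ij|ij].
  have -> : i = j' by apply: val_inj.
  by rewrite !mxE; move: yx; rewrite /c /mklin /= => ->; rewrite subrr.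
by rewrite !mxE x0 // y0 // subrr.
Qed.

Lemma row_kernel_fg r V (f : {linear 'rV[R]_r -> V}) :
  fin_gen (submodule (kernel f)).
Proof.
have [s sK sP] := row_submod_fg (kernel f).
pose v : {linear submodule (kernel f) -> 'rV[R]_r} :=
  mklin (fun a (x y : submodule (kernel f)) =>
           erefl : val (a *: x + y) = a *: val x + val y).
have [t ts] : exists t, map v t = s.
  elim: s sK {sP} => [|x s IHs] sK; first by exists [::].
  have [|t ts] := IHs; first by move=> y ys; apply: sK; rewrite inE ys orbT.
  by exists (Sub x (sK x (mem_head _ _)) :: t); congr (_ :: _).
exists t => x; apply: (gen_map_inj (f := v)); first exact: val_inj.
by rewrite ts; apply: sP; apply: (valP x).
Qed.

(** The left annihilators of the powers of u form an ascending chain. Once it is stationary at n, x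
    u = 0 puts x w^n in the annihilator of u^(n+1), hence of u^n, so x = 0. Right multiplication by
    u is thus injective, and it kills u w - 1. *)
Lemma left_noetherian_mulr_eq1 (u w : R) : w * u = 1 -> u * w = 1.
Proof.
move=> wu.
have Ks n : submod_closed (fun x : R^o => (x : R) * u ^+ n == 0).
  split=> [|a x y /eqP x0 /eqP y0]; first by apply/eqP; apply: mul0r.
  by apply/eqP; rewrite [LHS]mulrDl -[X in X + _]mulrA x0 y0 mulr0 addr0.
have [|n nP] := Rn (I := fun n => submod_of (Ks n)).
  by move=> n x /eqP x0; apply/eqP; rewrite exprSr mulrA x0 mul0r.
have wun m : w ^+ m * u ^+ m = 1.
  elim: m => [|m IHm]; first by rewrite mulr1.
  by rewrite exprSr exprS mulrA -(mulrA _ w) wu mulr1.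
have inj (x : R) : x * u = 0 -> x = 0.
  move=> xu; have : (x * w ^+ n : R^o) \in submod_of (Ks n.+1).
    by apply/eqP; rewrite exprSr mulrA -(mulrA x) wun mulr1.
  by rewrite nP // => /eqP; rewrite -mulrA wun mulr1.
apply/eqP; rewrite -subr_eq0; apply/eqP/inj.
by rewrite mulrBl -mulrA wu mulr1 mul1r subrr.
Qed.

End Generators.

(** * Modules that are finitely generated up to maps through free modules *)

Section Stable.
Variable R : nzRingType.
Hypothesis Rn : left_noetherian R.

(** The syzygies of the canonical resolution are not finitely generated. What passes from a module
    to its syzygy is this weaker property: the identity is a map through a finitely generated module
    plus a map through a free one. *)
Definition stably_fg (X : lmodType R) : Prop :=
  exists (O Z : lmodType R) (p : {linear X -> O}) (i : {linear O -> X})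
    (a : {linear X -> free_on Z}) (b : {linear free_on Z -> X}),
  fin_gen O /\ forall x, x = i (p x) + b (a x).

(* Schanuel's lemma, with the extra information that the map factoring through a
   free module factors through the inclusion of the syzygy. *)
Lemma syz_fg_approx (X : lmodType R) : stably_fg X ->
  exists (O : lmodType R) (p : {linear syz X -> O}) (i : {linear O -> syz X})
    (r : {linear free_on X -> syz X}),
  fin_gen O /\ forall x, x = i (p x) + r (syz_val X x).
Proof.
case=> O [Z [p [i [a [b [Ofg xE]]]]]].
have [n [rho rho_surj]] := fin_gen_cover Ofg.
pose cov : {linear free_on X -> X} := @free_cover R X.
have cov_surj x : exists u, cov u = x by exists << x >>; apply: free_coverU.
have [pt ptP] := free_lift (p \o cov : {linear _ -> _}) rho_surj.
have [it itP] := row_lift (i \o rho : {linear _ -> _}) cov_surj.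
have [bt btP] := free_lift b cov_surj.
have pk x : pt (syz_val X x) \in kernel rho.
  by apply/eqP; rewrite ptP /= free_cover_syz linear0.
have pl : linear (fun x => Sub (pt (syz_val X x)) (pk x) : submodule (kernel rho)).
  by move=> c x y; apply: val_inj; rewrite /= !linearP.
have ik (x : submodule (kernel rho)) : it (val x) \in kernel cov.
  by apply/eqP; rewrite itP /= (eqP (valP x)) linear0.
have il : linear (fun x => Sub (it (val x)) (ik x) : syz X).
  by move=> c x y; apply: val_inj; rewrite /= !linearP.
(* The identity x = i (p x) + b (a x), lifted to free covers, holds up to an error with values in
   the syzygy. This error is the map r; on the syzygy the term with b vanishes because it passes
   through [cov]. *)
have rk u : u - it (pt u) - bt (a (cov u)) \in kernel cov.
  apply/eqP; rewrite !linearB /= itP /= ptP btP /=.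
  by rewrite -addrA -opprD -xE subrr.
pose rm : {linear free_on X -> free_on X} :=
  idfun \- (it \o pt) \- (bt \o (a \o cov)).
have rl : linear (fun u => Sub (rm u) (rk u) : syz X).
  by move=> c x y; apply: val_inj; rewrite /= -(linearP rm).
exists (submodule (kernel rho)), (mklin pl), (mklin il), (mklin rl).
split; first exact: row_kernel_fg.
move=> x; apply: val_inj; rewrite /mklin /=.
have -> : cov (syz_val X x) = 0 by apply: free_cover_syz.
by rewrite (linear0 a) (linear0 bt) oppr0 addr0 addrC subrK.
Qed.

Lemma syz_stably_fg (X : lmodType R) : stably_fg X -> stably_fg (syz X).
Proof.
move=> /syz_fg_approx [O [p [i [r [Ofg xE]]]]].
by exists O, X, p, i, (syz_val X), r.
Qed.

(** The map through the free module becomes a coboundary because it extends from the syzygy. Hence a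
    cocycle is determined, up to coboundary, by its values on the images of finitely many generators
    of O, with O, p and i independent of the cocycle. *)
Lemma fin_gen_approx (T : lmodType R) n : fin_gen T ->
  exists (O : lmodType R) (p : {linear iter n (@syz R) T -> O})
    (i : {linear O -> iter n (@syz R) T}),
  fin_gen O /\ forall (N : lmodType R) (f : {linear iter n (@syz R) T -> N}),
    is_cob n (fun x => f x - f (i (p x))).
Proof.
move=> Tfg; case: n => [|n].
  exists T, (idfun : {linear T -> T}), (idfun : {linear T -> T}); split=> // N f x /=.
  by rewrite subrr.
have : stably_fg (iter n (@syz R) T).
  elim: n => [|n IHn] /=; last exact: syz_stably_fg.
  exists T, T, (idfun : {linear T -> T}), (idfun : {linear T -> T}).
  exists (\0 : {linear T -> free_on T}), (\0 : {linear free_on T -> T}).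
  by split=> // x /=; rewrite addr0.
move=> /syz_fg_approx [O [p [i [r [Ofg xE]]]]].
exists O, p, i; split=> // N f /=.
exists (f \o r : {linear _ -> _}) => x /=.
by rewrite -linearB {1}[x]xE addrC addKr.
Qed.

End Stable.

(** * Retractions of vector spaces *)

Section LinearComplement.
Variables (k : fieldType) (V : lmodType k).
Local Open Scope classical_set_scope.

Let subspace (T : set V) := T 0 /\ forall a x y, T x -> T y -> T (a *: x + y).

Lemma subspace_complement (S : set V) : subspace S ->
  exists2 T : set V, subspace T &
    (forall x, S x -> T x -> x = 0) /\
    (forall x, exists y z, [/\ S y, T z & x = y + z]).
Proof.
move=> [S0 SP].
(* Restricting the condition to nonempty T admits the union of the empty chain; a maximal T is
   nonempty since otherwise {0} would be larger. *)
pose P T := (exists x, T x) -> subspace T /\ (forall x, S x -> T x -> x = 0).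
have [F FP Fchain|T [PT Tmax]] := @Zorn_bigcup V P.
  move=> [x [X FX Xx]].
  have PF Y y : F Y -> Y y -> subspace Y /\ (forall x, S x -> Y x -> x = 0).
    by move=> FY Yy; apply: FP => //; exists y.
  split; first split.
  - by exists X => //; case: (PF _ _ FX Xx) => -[].
  - move=> a y z [Y FY Yy] [Z FZ Zz].
    case: (Fchain _ _ FY FZ) => YZ.
      by exists Z => //; apply: (PF _ _ FZ Zz).1.2 => //; apply: YZ.
    by exists Y => //; apply: (PF _ _ FY Yy).1.2 => //; apply: YZ.
  - by move=> y Sy [Y FY Yy]; apply: (PF _ _ FY Yy).2.
have Tne : exists x, T x.
  apply: contrapT => Te; apply: (Tmax [set 0]).
    split=> [x Tx|/(_ 0 erefl) T0]; first by case: Te; exists x.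
    by apply: Te; exists 0.
  by move=> _; split=> //; split=> // a x y -> ->; rewrite scaler0 addr0.
have [[T0 TP] ST] := PT Tne.
have SZ a x : S x -> S (a *: x) by move=> Sx; rewrite -[_ *: _]addr0; apply: SP.
have TZ a x : T x -> T (a *: x) by move=> Tx; rewrite -[_ *: _]addr0; apply: TP.
exists T => //; split=> // x; apply: contrapT => nx.
apply: (Tmax [set y | exists c t, T t /\ y = c *: x + t]).
  split=> [t Tt|BT]; first by exists 0, t; rewrite scale0r add0r.
  apply: nx; exists 0, x; rewrite add0r; split=> //; apply: BT.
  by exists 1, 0; rewrite scale1r addr0.
move=> _; split; first split.
- by exists 0, 0; rewrite scale0r addr0.
- move=> a _ _ [c [t [Tt ->]]] [c' [t' [Tt' ->]]].
  exists (a * c + c'), (a *: t + t'); split; first exact: TP.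
  by rewrite scalerDr scalerA scalerDl addrACA.
- move=> y Sy [c [t [Tt yE]]]; have [c0|cN0] := eqVneq c 0.
    by apply: ST => //; rewrite yE c0 scale0r add0r.
  case: nx; exists (c^-1 *: y), (- c^-1 *: t); split; [exact: SZ | exact: TZ |].
  by rewrite yE scalerDr scalerA mulVf // scale1r scaleNr addrK.
Qed.

Lemma linear_retraction (U : lmodType k) (i : {linear U -> V}) :
  injective i -> exists r : {linear V -> U}, forall u, r (i u) = u.
Proof.
move=> i_inj.
have [|T [T0 TP] [ST cover]] := @subspace_complement [set x | exists u, x = i u].
  split=> [|a _ _ [u ->] [v ->]]; first by exists 0; rewrite linear0.
  by exists (a *: u + v); rewrite linearP.
have rex x : exists u, T (x - i u).
  have [_ [z [[u ->] Tz ->]]] := cover x.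
  by exists u; rewrite addrC addKr.
have [r rP] := choice rex.
have rE x u : T (x - i u) -> r x = u.
  move=> Txu; apply: i_inj; apply/eqP; rewrite -subr_eq0; apply/eqP; apply: ST.
    by exists (r x - u); rewrite linearB.
  rewrite (_ : _ - _ = -1 *: (x - i (r x)) + (x - i u)); first exact: TP.
  by rewrite scaleN1r opprB addrA subrK.
have rl : linear r.
  move=> a x y; apply: rE; rewrite linearP opprD addrACA -scalerBr.
  exact: TP.
by exists (mklin rl) => u; apply: rE; rewrite subrr.
Qed.

End LinearComplement.

Lemma exists_functional (k : fieldType) (V : lmodType k) (y : V) :
  y != 0 -> exists l : {linear V -> k^o}, l y = 1.
Proof.
move=> y0.
have il : linear (fun c : k^o => c *: y).
  by move=> a c d; rewrite scalerDl scalerA.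
have [|r rP] := linear_retraction (i := mklin il).
  move=> c d /eqP; rewrite /mklin /= -subr_eq0 -scalerBl scaler_eq0 (negPf y0).
  by rewrite orbF subr_eq0 => /eqP.
by exists r; move: (rP 1); rewrite /mklin /= scale1r.
Qed.

(** The finite-rank operator is given by functionals and vectors because the functionals are what
    later becomes module maps, through [fun_transfer]. *)
Lemma finite_projection (k : fieldType) (V : lmodType k) (s : seq V) :
  exists b : seq ({linear V -> k^o} * V),
    forall x, x \in s -> x = \sum_(p <- b) p.1 x *: p.2.
Proof.
elim: s => [|x s [b bP]]; first by exists [::].
have ql : linear (fun v => \sum_(p <- b) p.1 v *: p.2).
  move=> a u v; rewrite scaler_sumr -big_split; apply: eq_bigr => p _ /=.
  by rewrite linearP scalerDl scalerA.
pose q : {linear V -> V} := mklin ql.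
have [xq|xq] := eqVneq (x - q x) 0.
  exists b => v; rewrite inE => /orP [/eqP ->|/bP //].
  by apply/eqP; rewrite -subr_eq0; apply/eqP.
have [l lP] := exists_functional xq.
(* Composing with the error of q makes the new functional vanish on all vectors that q already
   fixes, while it takes the value 1 at x. *)
pose l' : {linear V -> k^o} := l \o (idfun \- q).
have l'E v : l' v = l (v - q v) by [].
exists ((l', x - q x) :: b) => v; rewrite inE big_cons => /orP [/eqP ->|/bP vE].
  by rewrite [X in X *: _]l'E lP scale1r subrK.
have qv : q v = v by rewrite [RHS]vE.
by rewrite [X in X *: _]l'E qv subrr linear0 scale0r add0r.
Qed.

(** * Hopf algebras in Sweedler notation *)

Section Multilinear.
Variable k : fieldType.
Implicit Types U V W : lmodType k.

Lemma linearI U V (f : U -> V) : {morph f : u v / u + v} ->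
  (forall c, {morph f : u / c *: u}) -> linear f.
Proof. by move=> fD fZ c u v; rewrite fD fZ. Qed.

Lemma linear_scale U V (f : U -> V) : linear f ->
  forall c u, f (c *: u) = c *: f u.
Proof.
move=> fl c u; have : mklin fl (c *: u) = c *: mklin fl u by rewrite linearZ.
by [].
Qed.

Lemma linear_fun_sum U V (f : U -> V) : linear f ->
  forall (I : Type) (s : seq I) (F : I -> U),
  f (\sum_(i <- s) F i) = \sum_(i <- s) f (F i).
Proof. by move=> fl I s F; apply: (linear_sum (mklin fl)). Qed.

Definition bilin U V W (f : U -> V -> W) :=
  (forall v, linear (f^~ v)) /\ (forall u, linear (f u)).

Definition trilin U U' V W (f : U -> U' -> V -> W) :=
  [/\ forall u' v, linear (fun u => f u u' v),
      forall u v, linear (fun u' => f u u' v) & forall u u', linear (f u u')].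

End Multilinear.

(* A Hopf algebra structure with the comultiplication in Sweedler form:
   Delta x is the sum of p.1 (x) p.2 over the p in hD x. *)
Record hopf_data (k : fieldType) (A : algType k) := HopfData {
  hD : A -> seq (A * A);
  hS : {linear A -> A};
  heps : {linear A -> k^o};
  hepsM : forall x y, heps (x * y) = heps x * heps y;
  heps1 : heps 1 = 1;
  hD_linear : forall (W : lmodType k) (f : A -> A -> W), bilin f ->
    linear (fun x => \sum_(p <- hD x) f p.1 p.2);
  hD1 : forall (W : lmodType k) (f : A -> A -> W), bilin f ->
    \sum_(p <- hD 1) f p.1 p.2 = f 1 1;
  hDM : forall (W : lmodType k) (f : A -> A -> W) x y, bilin f ->
    \sum_(p <- hD (x * y)) f p.1 p.2 =
    \sum_(p <- hD x) \sum_(q <- hD y) f (p.1 * q.1) (p.2 * q.2);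
  hDA : forall (W : lmodType k) (f : A -> A -> A -> W) x, trilin f ->
    \sum_(p <- hD x) \sum_(q <- hD p.1) f q.1 q.2 p.2 =
    \sum_(p <- hD x) \sum_(q <- hD p.2) f p.1 q.1 q.2;
  hDel : forall x, \sum_(p <- hD x) heps p.1 *: p.2 = x;
  hDer : forall x, \sum_(p <- hD x) heps p.2 *: p.1 = x;
  hDSl : forall x, \sum_(p <- hD x) hS p.1 * p.2 = (heps x)%:A;
  hDSr : forall x, \sum_(p <- hD x) p.1 * hS p.2 = (heps x)%:A
}.

Ltac linD := rewrite ?(mulrDl, mulrDr, linearD, scalerDr, scalerDl) /=.
Ltac linZ := rewrite -?(scalerAl, scalerAr) ?linearZ /=
  -?(scalerAl, scalerAr) ?linearZ /=.
Ltac lin := apply: linearI => [? ? | ? ?] /=; [linD | linZ]; try by [].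

Section Sweedler.
Variables (k : fieldType) (A : algType k) (h : hopf_data A).
Implicit Types (U V W : lmodType k) (x y z : A).
Local Notation S := (hS h).
Local Notation eps := (heps h).

Definition sw W x (f : A -> A -> W) : W := \sum_(p <- hD h x) f p.1 p.2.

Lemma eq_sw W x (f g : A -> A -> W) :
  (forall a b, f a b = g a b) -> sw x f = sw x g.
Proof. by move=> fg; apply: eq_bigr => p _; apply: fg. Qed.

Lemma linear_sw U V (g : {linear U -> V}) x (f : A -> A -> U) :
  g (sw x f) = sw x (fun a b => g (f a b)).
Proof. exact: linear_sum. Qed.

Lemma sw_lin U V (g : U -> V) x (f : A -> A -> U) : linear g ->
  g (sw x f) = sw x (fun a b => g (f a b)).
Proof. by move=> gl; apply: (linear_sw (mklin gl)). Qed.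

Lemma sw_linear W (f : A -> A -> W) : bilin f -> linear (fun x => sw x f).
Proof. exact: hD_linear. Qed.

Lemma sw_exchange W x y (f : A -> A -> A -> A -> W) :
  sw x (fun a b => sw y (f a b)) = sw y (fun c d => sw x (fun a b => f a b c d)).
Proof. exact: exchange_big. Qed.

Lemma swM W x y (f : A -> A -> W) : bilin f ->
  sw (x * y) f = sw x (fun a b => sw y (fun c d => f (a * c) (b * d))).
Proof. exact: hDM. Qed.

Lemma sw1 W (f : A -> A -> W) : bilin f -> sw 1 f = f 1 1.
Proof. exact: hD1. Qed.

Lemma sw_assoc W x (f : A -> A -> A -> W) : trilin f ->
  sw x (fun a b => sw a (fun c d => f c d b)) =
  sw x (fun a b => sw b (fun c d => f a c d)).
Proof. exact: hDA. Qed.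

Lemma sw_epsl W (g : A -> W) x : linear g ->
  sw x (fun a b => eps a *: g b) = g x.
Proof.
move=> gl.
transitivity (mklin gl (\sum_(p <- hD h x) eps p.1 *: p.2)); last by rewrite hDel.
by rewrite linear_sum; apply: eq_bigr => p _; rewrite linearZ.
Qed.

Lemma sw_epsr W (g : A -> W) x : linear g ->
  sw x (fun a b => eps b *: g a) = g x.
Proof.
move=> gl.
transitivity (mklin gl (\sum_(p <- hD h x) eps p.2 *: p.1)); last by rewrite hDer.
by rewrite linear_sum; apply: eq_bigr => p _; rewrite linearZ.
Qed.

Section Contraction.
Variables (T : A -> A -> A) (TE : forall x, sw x T = eps x *: 1).

(** T stands for any antipode product whose Sweedler sum is the counit: those of [sw_Sl], [sw_Sr],
    [sw_SSl] and [sw_SSr]. *)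
Lemma sw_contract_r W (G : A -> A -> W) x : bilin G ->
  sw x (fun a b => sw b (fun c d => G a (T c d))) = G x 1.
Proof.
move=> [Gl Gr]; rewrite -[RHS](sw_epsr x (Gl 1)); apply: eq_sw => a b.
by rewrite -(sw_lin _ _ (Gr a)) TE (linear_scale (Gr a)).
Qed.

Lemma sw_contract_l W (G : A -> A -> W) x : bilin G ->
  sw x (fun a b => sw a (fun c d => G (T c d) b)) = G 1 x.
Proof.
move=> [Gl Gr]; rewrite -[RHS](sw_epsl x (Gr 1)); apply: eq_sw => a b.
by rewrite -(sw_lin _ _ (Gl b)) TE (linear_scale (Gl b)).
Qed.

End Contraction.

Lemma sw_Sl x : sw x (fun a b => S a * b) = eps x *: 1.
Proof. exact: hDSl. Qed.

Lemma sw_Sr x : sw x (fun a b => a * S b) = eps x *: 1.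
Proof. exact: hDSr. Qed.

Lemma hS1 : S 1 = 1.
Proof.
have b : bilin (fun a b : A => S a * b) by split=> ?; lin.
by have := sw_Sl 1; rewrite sw1 // mulr1 heps1 scale1r.
Qed.

(** Uniqueness of convolution inverses, written out: S(x y) = S(x_1 y_1) x_2 y_2 S(y_3) S(x_3),
    where the product of the first three factors collapses to the counit. *)
Lemma hSM x y : S (x * y) = S y * S x.
Proof.
have -> : S (x * y) = sw x (fun a b => sw a (fun a1 a2 =>
    S (a1 * y) * (a2 * S b))).
  rewrite sw_assoc; last by split=> ? ?; lin.
  rewrite (sw_contract_r sw_Sr (G := fun a t => S (a * y) * t)) ?mulr1 //.
  by split=> ?; lin.
have step a1 a2 b : S (a1 * y) * (a2 * S b) = sw y (fun c d => sw c (fun c1 c2 =>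
    S (a1 * c1) * (a2 * c2) * (S d * S b))).
  transitivity (sw y (fun c d => sw c (fun c1 c2 =>
      S (a1 * c1) * (a2 * (c2 * S d) * S b)))).
    rewrite sw_assoc; last by split=> ? ?; lin.
    rewrite (sw_contract_r sw_Sr (G := fun c t => S (a1 * c) * (a2 * t * S b))).
      by rewrite mulr1.
    by split=> ?; lin.
  by do 2!apply: eq_sw => ? ?; rewrite !mulrA.
transitivity (sw x (fun a b => eps a *: (S y * S b))); last first.
  by apply: (sw_epsl (g := fun b => S y * S b)); lin.
apply: eq_sw => a b; under eq_sw => a1 a2 do rewrite step.
rewrite sw_exchange.
transitivity (sw y (fun c d => eps c *: (eps a *: (S d * S b)))); last first.
  by apply: (sw_epsl (g := fun d => eps a *: (S d * S b))); lin; rewrite scalerCA.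
apply: eq_sw => c d.
transitivity (sw (a * c) (fun u v => S u * v) * (S d * S b)).
  rewrite swM; last by split=> ?; lin.
  rewrite (sw_lin _ _ (g := fun t => t * (S d * S b))); last by lin.
  by apply: eq_sw => ? ?; rewrite (sw_lin _ _ (g := fun t => t * (S d * S b))) //; lin.
by rewrite sw_Sl hepsM -scalerAl mul1r scalerA mulrC.
Qed.

(** The antihomomorphism S is applied to an antipode axiom. This and [sw_SSr] are the cancellations
    that make the untwisting invertible without an inverse of S. *)
Lemma sw_SSl x : sw x (fun a b => S b * S (S a)) = eps x *: 1.
Proof.
transitivity (S (sw x (fun a b => S a * b))).
  by rewrite linear_sw; apply: eq_sw => a b; rewrite hSM.
by rewrite sw_Sl linearZ /= hS1.
Qed.

Lemma sw_SSr x : sw x (fun a b => S (S b) * S a) = eps x *: 1.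
Proof.
transitivity (S (sw x (fun a b => a * S b))).
  by rewrite linear_sw; apply: eq_sw => a b; rewrite hSM.
by rewrite sw_Sr linearZ /= hS1.
Qed.

End Sweedler.

(* Right A-modules are left A^c-modules, and A^c is a Hopf algebra with the
   opposite comultiplication and the same antipode. *)
Section OpCop.
Variables (k : fieldType) (A : algType k) (h : hopf_data A).

Let D (x : A^c) : seq (A^c * A^c) := [seq (p.2, p.1) | p <- hD h x].

Let DE (W : nmodType) (f : A^c -> A^c -> W) x :
  \sum_(p <- D x) f p.1 p.2 = \sum_(p <- hD h x) f p.2 p.1.
Proof. by rewrite big_map. Qed.

Let bilin_swap (W : lmodType k) (f : A^c -> A^c -> W) :
  bilin f -> bilin (fun a b : A => f b a).
Proof. by move=> [fl fr]; split. Qed.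

Let Sl : linear (hS h : A^c -> A^c).
Proof. exact: (linearP (hS h)). Qed.

Let el : linear (heps h : A^c -> k^o).
Proof. exact: (linearP (heps h)). Qed.

Let eM (x y : A^c) : heps h (x * y) = heps h x * heps h y.
Proof. by rewrite mulrC; apply: (hepsM h y x). Qed.

Let D_linear (W : lmodType k) (f : A^c -> A^c -> W) : bilin f ->
  linear (fun x => \sum_(p <- D x) f p.1 p.2).
Proof.
by move=> /bilin_swap fb c x y; rewrite !DE; apply: (hD_linear h fb).
Qed.

Let D1 (W : lmodType k) (f : A^c -> A^c -> W) : bilin f ->
  \sum_(p <- D 1) f p.1 p.2 = f 1 1.
Proof. by move=> /bilin_swap fb; rewrite !DE; apply: (hD1 h fb). Qed.

Let DM (W : lmodType k) (f : A^c -> A^c -> W) x y : bilin f ->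
  \sum_(p <- D (x * y)) f p.1 p.2 =
  \sum_(p <- D x) \sum_(q <- D y) f (p.1 * q.1) (p.2 * q.2).
Proof.
move=> /bilin_swap fb; rewrite DE.
rewrite (hDM h y x fb) exchange_big /=.
by rewrite big_map; apply: eq_bigr => p _; rewrite big_map.
Qed.

Let DA (W : lmodType k) (f : A^c -> A^c -> A^c -> W) x : trilin f ->
  \sum_(p <- D x) \sum_(q <- D p.1) f q.1 q.2 p.2 =
  \sum_(p <- D x) \sum_(q <- D p.2) f p.1 q.1 q.2.
Proof.
move=> [f1 f2 f3].
have ft : trilin (fun a b c : A => f c b a) by split.
rewrite !big_map; under eq_bigr do rewrite big_map.
under [in RHS]eq_bigr do rewrite big_map.
by rewrite -(hDA h x ft).
Qed.

Let Del (x : A^c) : \sum_(p <- D x) heps h p.1 *: p.2 = x.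
Proof. by rewrite big_map; apply: (hDer h x). Qed.

Let Der (x : A^c) : \sum_(p <- D x) heps h p.2 *: p.1 = x.
Proof. by rewrite big_map; apply: (hDel h x). Qed.

Let DSl (x : A^c) : \sum_(p <- D x) (hS h p.1 : A^c) * p.2 = (heps h x)%:A.
Proof. by rewrite big_map; apply: (hDSr h x). Qed.

Let DSr (x : A^c) : \sum_(p <- D x) p.1 * (hS h p.2 : A^c) = (heps h x)%:A.
Proof. by rewrite big_map; apply: (hDSl h x). Qed.

Definition opcop : hopf_data A^c :=
  HopfData (hS := mklin Sl) (heps := mklin el) eM (heps1 h) D_linear D1 DM DA
    Del Der DSl DSr.

End OpCop.

Lemma tensor_span (k : fieldType) (V W : lmodType k) (t : tensor V W) :
  exists s : seq (V * W), t = \sum_(p <- s) tens p.1 p.2.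
Proof.
pose pi : {linear {freeg (V * W)%type / k} -> tensor V W} := quotmod_pi _.
have -> : t = pi (repr t) by rewrite [RHS]quotmod_repr.
rewrite (freeg_lin_sum pi).
exists [seq (coeff x (repr t) *: x.1, x.2) | x <- dom (repr t)].
rewrite [RHS]big_map; apply: eq_bigr => -[v w] _ /=.
by rewrite (linear_scale (fun c x y => tensPl c x y w)).
Qed.

(** * Sweedler data of the given Hopf algebra *)

Section OfHopf.
Variables (k : fieldType) (H : hopfAlgType k).

Let D (x : H) : seq (H * H) := sval (cid (tensor_span (comul H x))).

Let comulE x : comul H x = \sum_(p <- D x) tens p.1 p.2.
Proof. by rewrite /D; case: cid. Qed.

Let bilinE (U V W : lmodType k) (f : U -> V -> W) :
  bilin f -> bilinear_for *:%R *:%R f.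
Proof. by move=> [fl fr]; split=> u; [apply: fl | apply: fr]. Qed.

Let liftE (U V W : lmodType k) (f : U -> V -> W) (s : seq (U * V)) : bilin f ->
  tensor_lift f (\sum_(p <- s) tens p.1 p.2) = \sum_(p <- s) f p.1 p.2.
Proof.
move=> fb; rewrite (linear_fun_sum (tensor_lift_linear (bilinE fb))).
by apply: eq_bigr => p _; rewrite /mklin /= tensor_liftE //; apply: bilinE.
Qed.

Let DE (W : lmodType k) (f : H -> H -> W) x : bilin f ->
  \sum_(p <- D x) f p.1 p.2 = tensor_lift f (comul H x).
Proof. by move=> fb; rewrite comulE liftE. Qed.

Let D_linear (W : lmodType k) (f : H -> H -> W) : bilin f ->
  linear (fun x => \sum_(p <- D x) f p.1 p.2).
Proof.
move=> fb c x y; rewrite !DE // linearP.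
exact: (tensor_lift_linear (bilinE fb)).
Qed.

Let D1 (W : lmodType k) (f : H -> H -> W) : bilin f ->
  \sum_(p <- D 1) f p.1 p.2 = f 1 1.
Proof. by move=> fb; rewrite DE // comul1 tensor_liftE //; apply: bilinE. Qed.

Let mul_bilin (a b : H) :
  bilin (fun a' b' : H => tens (a * a') (b * b') : tensor H H).
Proof. by split=> ? ? ? ?; rewrite mulrDr -scalerAr ?tensPl ?tensPr. Qed.

Let mulE (s t : seq (H * H)) :
  tensor_mul (\sum_(p <- s) tens p.1 p.2) (\sum_(q <- t) tens q.1 q.2) =
  \sum_(p <- s) \sum_(q <- t) tens (p.1 * q.1) (p.2 * q.2) :> tensor H H.
Proof.
rewrite /tensor_mul liftE; last first.
  split=> ? c ? ?; rewrite -tensor_lift_fun; apply: eq_tensor_lift => ? ?;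
    by rewrite mulrDl -scalerAl ?tensPl ?tensPr.
by apply: eq_bigr => p _; rewrite liftE //; apply: mul_bilin.
Qed.

Let DM (W : lmodType k) (f : H -> H -> W) x y : bilin f ->
  \sum_(p <- D (x * y)) f p.1 p.2 =
  \sum_(p <- D x) \sum_(q <- D y) f (p.1 * q.1) (p.2 * q.2).
Proof.
move=> fb; rewrite DE // comulM !comulE mulE.
rewrite (linear_fun_sum (tensor_lift_linear (bilinE fb))).
apply: eq_bigr => p _.
rewrite (linear_fun_sum (tensor_lift_linear (bilinE fb))).
by apply: eq_bigr => q _; rewrite /mklin /= tensor_liftE //; apply: bilinE.
Qed.

Let DA (W : lmodType k) (f : H -> H -> H -> W) x : trilin f ->
  \sum_(p <- D x) \sum_(q <- D p.1) f q.1 q.2 p.2 =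
  \sum_(p <- D x) \sum_(q <- D p.2) f p.1 q.1 q.2.
Proof.
move=> [f1 f2 f3].
have fb a : bilin (f a) by split.
(* The map induced by f on H (x) (H (x) H), through which the tensor identity [comulA] is
   evaluated. *)
pose g (a : H) (t : tensor H H) := tensor_lift (f a) t.
have gb : bilin g.
  split=> [t|a]; last exact: (tensor_lift_linear (bilinE (fb a))).
  move=> c a b; rewrite /g -tensor_lift_fun; apply: eq_tensor_lift => u v.
  exact: f1.
have gE a b c : g a (tens b c) = f a b c.
  by rewrite /g tensor_liftE //; apply: bilinE.
have glin : linear (tensor_lift g) := tensor_lift_linear (bilinE gb).
have glE a b c : tensor_lift g (tens a (tens b c)) = f a b c.
  by rewrite tensor_liftE ?gE //; apply: bilinE.
have assocl : linear (@tensor_assoc k H H H).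
  apply: tensor_lift_linear; apply: bilinE; split=> [w|t].
    apply: tensor_lift_linear; apply: bilinE; split=> ? ? ? ?;
    by rewrite ?tensPl ?tensPr.
  move=> c u v; rewrite -tensor_lift_fun; apply: eq_tensor_lift => ? ?.
  by rewrite !tensPr.
have := congr1 (tensor_lift g) (comulA x).
rewrite !comulE /tensor_map liftE; last first.
  by split=> ? ? ? ?; rewrite ?linearP ?tensPl ?tensPr.
rewrite liftE; last by split=> ? ? ? ?; rewrite ?linearP ?tensPl ?tensPr.
rewrite (linear_fun_sum assocl) !(linear_fun_sum glin).
rewrite /mklin /=.
under eq_bigr => p _.
  rewrite comulE.
  have tl : linear (fun t : tensor H H => tens t p.2 : tensor (tensor H H) H).
    by move=> ? ? ?; rewrite tensPl.
  rewrite (linear_fun_sum tl) (linear_fun_sum assocl).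
  rewrite (linear_fun_sum glin) /mklin /=.
  under eq_bigr => q _ do rewrite tensor_assocE glE.
  over.
move=> ->; apply: eq_bigr => p _; rewrite comulE.
have tl : linear (fun t : tensor H H => tens p.1 t : tensor H (tensor H H)).
  by move=> ? ? ?; rewrite tensPr.
rewrite (linear_fun_sum tl) (linear_fun_sum glin) /mklin /=.
by apply: eq_bigr => q _; rewrite glE.
Qed.

Let eps_lin : linear (counit H : H -> k^o).
Proof. exact: (linearP (counit H)). Qed.

Let Del x : \sum_(p <- D x) counit H p.1 *: p.2 = x.
Proof.
rewrite (DE (f := fun a b => counit H a *: b)); first exact: counitl.
by split=> ? ? ? ?; rewrite ?linearP ?scalerDl ?scalerDr ?scalerA // mulrC.
Qed.

Let Der x : \sum_(p <- D x) counit H p.2 *: p.1 = x.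
Proof.
rewrite (DE (f := fun a b => counit H b *: a)); first exact: counitr.
by split=> ? ? ? ?; rewrite ?linearP ?scalerDl ?scalerDr ?scalerA // mulrC.
Qed.

Let DSl x : \sum_(p <- D x) antipode H p.1 * p.2 = (counit H x)%:A.
Proof.
rewrite (DE (f := fun a b => antipode H a * b)); first exact: antipodel.
by split=> ?; lin.
Qed.

Let DSr x : \sum_(p <- D x) p.1 * antipode H p.2 = (counit H x)%:A.
Proof.
rewrite (DE (f := fun a b => a * antipode H b)); first exact: antipoder.
by split=> ?; lin.
Qed.

Definition hopf_of : hopf_data H :=
  HopfData (hS := antipode H) (heps := mklin eps_lin)
    (rmorphM (counit H)) (rmorph1 (counit H)) D_linear D1 DM DA Del Der DSl DSr.

End OfHopf.

(** * Bimodules and their coinduced resolution *)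

Record bimod (k : fieldType) (A : algType k) := Bimod {
  bsort :> lmodType k;
  lact : A -> bsort -> bsort;
  ract : A -> bsort -> bsort;
  lact_bilin : bilin lact;
  ract_bilin : bilin ract;
  lact1 : forall x, lact 1 x = x;
  ract1 : forall x, ract 1 x = x;
  lactM : forall a b x, lact (a * b) x = lact a (lact b x);
  ractM : forall a b x, ract (a * b) x = ract b (ract a x);
  lractC : forall a b x, lact a (ract b x) = ract b (lact a x)
}.

Record bmor (k : fieldType) (A : algType k) (M N : bimod A) := Bmor {
  bfun :> {linear M -> N};
  bfun_lact : forall a x, bfun (lact a x) = lact a (bfun x);
  bfun_ract : forall a x, bfun (ract a x) = ract a (bfun x)
}.

Section BimodTheory.
Variables (k : fieldType) (A : algType k).
Implicit Types (M N : bimod A) (a b x y : A).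

Definition central N (z : N) := forall a, lact a z = ract a z.

Lemma lactDl N a b (n : N) : lact (a + b) n = lact a n + lact b n.
Proof. by have := (lact_bilin N).1 n 1 a b; rewrite /= !scale1r. Qed.

Lemma ractDl N a b (n : N) : ract (a + b) n = ract a n + ract b n.
Proof. by have := (ract_bilin N).1 n 1 a b; rewrite /= !scale1r. Qed.

Lemma lactDr N a (m n : N) : lact a (m + n) = lact a m + lact a n.
Proof. by have := (lact_bilin N).2 a 1 m n; rewrite /= !scale1r. Qed.

Lemma ractDr N a (m n : N) : ract a (m + n) = ract a m + ract a n.
Proof. by have := (ract_bilin N).2 a 1 m n; rewrite /= !scale1r. Qed.

Lemma lactZl N c a (n : N) : lact (c *: a) n = c *: lact a n.
Proof. exact: (linear_scale ((lact_bilin N).1 n)). Qed.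

Lemma ractZl N c a (n : N) : ract (c *: a) n = c *: ract a n.
Proof. exact: (linear_scale ((ract_bilin N).1 n)). Qed.

Lemma lactZr N a c (n : N) : lact a (c *: n) = c *: lact a n.
Proof. exact: (linear_scale ((lact_bilin N).2 a)). Qed.

Lemma ractZr N a c (n : N) : ract a (c *: n) = c *: ract a n.
Proof. exact: (linear_scale ((ract_bilin N).2 a)). Qed.

Definition bactD := (lactDl, ractDl, lactDr, ractDr).
Definition bactZ := (lactZl, ractZl, lactZr, ractZr).

Section Coinduced.
Variable N : bimod A.

Definition is_bilin (f : A -> A -> N) : bool := `[< bilin f >].

Lemma is_bilin_closed : submod_closed is_bilin.
Proof.
split=> [|c f g /asboolP [f1 f2] /asboolP [g1 g2]]; apply/asboolP.
  by split=> u a v w; rewrite scaler0 addr0.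
have E u v : (c *: f + g) u v = c *: f u v + g u v by [].
split=> u a v w; rewrite !E.
  by rewrite (f1 u) (g1 u) !scalerDr !scalerA mulrC addrACA.
by rewrite (f2 u) (g2 u) !scalerDr !scalerA mulrC addrACA.
Qed.

(** Hom_k(A (x) A, N), the bimodule coinduced from the vector space N; [coind_in] below sends n to
    (x, y) |-> x n y. *)
Definition coind_sort : lmodType k := submodule (submod_of is_bilin_closed).

Definition coind_fun (f : coind_sort) : A -> A -> N := val f.

Lemma coind_bilin (f : coind_sort) : bilin (coind_fun f).
Proof. exact/asboolP/(valP f). Qed.

Definition mk_coind (f : A -> A -> N) (fb : bilin f) : coind_sort :=
  Sub f (introT (asboolP _) fb).

Lemma mk_coindE f (fb : bilin f) : coind_fun (mk_coind fb) = f.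
Proof. by []. Qed.

Lemma coind_ext (f g : coind_sort) :
  (forall x y, coind_fun f x y = coind_fun g x y) -> f = g.
Proof. by move=> fg; apply: val_inj; do 2!apply: funext => ?; apply: fg. Qed.

Lemma coind_funP c (f g : coind_sort) x y :
  coind_fun (c *: f + g) x y = c *: coind_fun f x y + coind_fun g x y.
Proof. by []. Qed.

Lemma coind_lact_subproof a (f : coind_sort) :
  bilin (fun x y => coind_fun f (x * a) y).
Proof.
have [f1 f2] := coind_bilin f.
by split=> u c v w; rewrite ?mulrDl -?scalerAl ?(f1 u) ?(f2 (u * a)).
Qed.

Definition coind_lact a f := mk_coind (coind_lact_subproof a f).

Lemma coind_ract_subproof a (f : coind_sort) :
  bilin (fun x y => coind_fun f x (a * y)).
Proof.
have [f1 f2] := coind_bilin f.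
by split=> u c v w; rewrite ?mulrDr -?scalerAr ?(f1 (a * u)) ?(f2 u).
Qed.

Definition coind_ract a f := mk_coind (coind_ract_subproof a f).

Program Definition coind : bimod A :=
  Bimod (bsort := coind_sort) (lact := coind_lact) (ract := coind_ract) _ _ _ _ _ _ _.
Next Obligation.
split=> [f c a b|a c f g]; apply: coind_ext => x y.
  rewrite coind_funP !mk_coindE mulrDr -scalerAr; exact: (coind_bilin f).1.
by rewrite coind_funP !mk_coindE.
Qed.
Next Obligation.
split=> [f c a b|a c f g]; apply: coind_ext => x y.
  rewrite coind_funP !mk_coindE mulrDl -scalerAl; exact: (coind_bilin f).2.
by rewrite coind_funP !mk_coindE.
Qed.
Next Obligation. by move=> f; apply: coind_ext => x y; rewrite mk_coindE mulr1. Qed.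
Next Obligation. by move=> f; apply: coind_ext => x y; rewrite mk_coindE mul1r. Qed.
Next Obligation. by move=> a b f; apply: coind_ext => x y; rewrite !mk_coindE mulrA. Qed.
Next Obligation. by move=> a b f; apply: coind_ext => x y; rewrite !mk_coindE mulrA. Qed.
Next Obligation. by move=> a b f; apply: coind_ext => x y; rewrite !mk_coindE. Qed.

Lemma coind_in_subproof (n : N) : bilin (fun x y => lact x (ract y n)).
Proof. by split=> u c v w; rewrite !bactD !bactZ. Qed.

Lemma coind_in_linear : linear (fun n => mk_coind (coind_in_subproof n)).
Proof.
move=> c m n; apply: coind_ext => x y; rewrite coind_funP !mk_coindE.
by rewrite !bactD !bactZ.
Qed.

Program Definition coind_in : bmor N coind := Bmor (bfun := mklin coind_in_linear) _ _.
Next Obligation.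
by move=> a n; apply: coind_ext => x y; rewrite /mklin /= !mk_coindE -lractC lactM.
Qed.
Next Obligation.
by move=> a n; apply: coind_ext => x y; rewrite /mklin /= !mk_coindE ractM.
Qed.

Lemma coind_inE n x y : coind_fun (coind_in n) x y = lact x (ract y n).
Proof. by []. Qed.

Lemma coind_in_inj : injective coind_in.
Proof.
move=> m n /(congr1 (fun f => coind_fun f 1 1)).
by rewrite !coind_inE !lact1 !ract1.
Qed.

Lemma coind_img_closed : submod_closed (fun f : coind => `[< exists n, f = coind_in n >]).
Proof.
split=> [|c _ _ /asboolP [m ->] /asboolP [n ->]]; apply/asboolP.
  by exists 0; rewrite linear0.
by exists (c *: m + n); rewrite linearP.
Qed.

Definition coker_sort : lmodType k := quotmod (submod_of coind_img_closed).

Definition coker_pi : {linear coind -> coker_sort} := quotmod_pi _.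

Lemma coker_pi_eq (f g : coind) :
  coker_pi f = coker_pi g <-> exists n, f - g = coind_in n.
Proof.
by split=> [/quotmod_piP/asboolP|fg] //; apply/quotmod_piP/asboolP.
Qed.

Lemma coker_pi_surj (u : coker_sort) : exists f, coker_pi f = u.
Proof. by exists (repr u); apply: quotmod_repr. Qed.

Definition coker_lact a (u : coker_sort) : coker_sort :=
  coker_pi (lact a (repr u : coind)).

Definition coker_ract a (u : coker_sort) : coker_sort :=
  coker_pi (ract a (repr u : coind)).

Lemma coker_lactE a f : coker_lact a (coker_pi f) = coker_pi (lact a f).
Proof.
apply/coker_pi_eq.
have /coker_pi_eq [n nE] : coker_pi (repr (coker_pi f)) = coker_pi f := quotmod_repr _.
exists (lact a n); rewrite bfun_lact -nE.
by rewrite [in RHS]lactDr -[in RHS]scaleN1r lactZr scaleN1r.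
Qed.

Lemma coker_ractE a f : coker_ract a (coker_pi f) = coker_pi (ract a f).
Proof.
apply/coker_pi_eq.
have /coker_pi_eq [n nE] : coker_pi (repr (coker_pi f)) = coker_pi f := quotmod_repr _.
exists (ract a n); rewrite bfun_ract -nE.
by rewrite [in RHS]ractDr -[in RHS]scaleN1r ractZr scaleN1r.
Qed.

Program Definition coker : bimod A :=
  Bimod (bsort := coker_sort) (lact := coker_lact) (ract := coker_ract) _ _ _ _ _ _ _.
Next Obligation.
split=> [u c a b|a c u v].
  have [f <-] := coker_pi_surj u.
  by rewrite !coker_lactE lactDl lactZl linearP.
have [f <-] := coker_pi_surj u; have [g <-] := coker_pi_surj v.
by rewrite -linearP !coker_lactE lactDr lactZr linearP.
Qed.
Next Obligation.
split=> [u c a b|a c u v].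
  have [f <-] := coker_pi_surj u.
  by rewrite !coker_ractE ractDl ractZl linearP.
have [f <-] := coker_pi_surj u; have [g <-] := coker_pi_surj v.
by rewrite -linearP !coker_ractE ractDr ractZr linearP.
Qed.
Next Obligation.
by move=> u; have [f <-] := coker_pi_surj u; rewrite coker_lactE lact1.
Qed.
Next Obligation.
by move=> u; have [f <-] := coker_pi_surj u; rewrite coker_ractE ract1.
Qed.
Next Obligation.
by move=> a b u; have [f <-] := coker_pi_surj u; rewrite !coker_lactE lactM.
Qed.
Next Obligation.
by move=> a b u; have [f <-] := coker_pi_surj u; rewrite !coker_ractE ractM.
Qed.
Next Obligation.
move=> a b u; have [f <-] := coker_pi_surj u.
by rewrite coker_ractE !coker_lactE coker_ractE lractC.
Qed.

Program Definition coker_proj : bmor coind coker :=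
  Bmor (bfun := (coker_pi : {linear coind -> coker})) _ _.
Next Obligation. by move=> a f; apply: esym (coker_lactE a f). Qed.
Next Obligation. by move=> a f; apply: esym (coker_ractE a f). Qed.

Lemma coker_proj_surj (u : coker) : exists f, coker_proj f = u.
Proof. exact: coker_pi_surj. Qed.

Lemma coker_proj0 f : coker_proj f = 0 <-> exists n, f = coind_in n.
Proof.
rewrite -(linear0 coker_proj); split=> [/coker_pi_eq [n]|[n fn]].
  by rewrite subr0; exists n.
by apply/coker_pi_eq; exists n; rewrite subr0.
Qed.

End Coinduced.

Section Functoriality.
Variables (M N : bimod A) (f : bmor M N).

Lemma coind_map_subproof (g : coind M) : bilin (fun x y => f (coind_fun g x y)).
Proof.
have [g1 g2] := coind_bilin g.
by split=> u c v w; rewrite ?(g1 u) ?(g2 u) linearP.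
Qed.

Lemma coind_map_linear :
  linear (fun g : coind M => mk_coind (coind_map_subproof g) : coind N).
Proof.
move=> c g g'; apply: coind_ext => x y.
by rewrite coind_funP !mk_coindE coind_funP linearP.
Qed.

Program Definition coind_map : bmor (coind M) (coind N) :=
  Bmor (bfun := mklin coind_map_linear) _ _.
Next Obligation. by move=> a g; apply: coind_ext. Qed.
Next Obligation. by move=> a g; apply: coind_ext. Qed.

Lemma coind_map_in n : coind_map (coind_in M n) = coind_in N (f n).
Proof.
apply: coind_ext => x y; rewrite coind_inE /= /mklin /= mk_coindE coind_inE.
by rewrite bfun_lact bfun_ract.
Qed.

Definition coker_map_fun (u : coker M) : coker N :=
  coker_proj N (coind_map (repr (u : coker_sort M))).

Lemma coker_map_funE g : coker_map_fun (coker_proj M g) = coker_proj N (coind_map g).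
Proof.
apply/coker_pi_eq.
have /coker_pi_eq [n nE] :
  coker_pi M (repr (coker_pi M g)) = coker_pi M g := quotmod_repr _.
by exists (f n); rewrite -coind_map_in -nE linearB.
Qed.

Lemma coker_map_linear : linear coker_map_fun.
Proof.
move=> c u v; have [g <-] := coker_proj_surj u; have [g' <-] := coker_proj_surj v.
by rewrite -linearP !coker_map_funE !linearP.
Qed.

Program Definition coker_map : bmor (coker M) (coker N) :=
  Bmor (bfun := mklin coker_map_linear) _ _.
Next Obligation.
move=> a u; have [g <-] := coker_proj_surj u.
change (coker_map_fun (lact a (coker_proj M g)) =
        lact a (coker_map_fun (coker_proj M g))).
by rewrite -(bfun_lact (coker_proj M)) !coker_map_funE !bfun_lact.
Qed.
Next Obligation.
move=> a u; have [g <-] := coker_proj_surj u.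
change (coker_map_fun (ract a (coker_proj M g)) =
        ract a (coker_map_fun (coker_proj M g))).
by rewrite -(bfun_ract (coker_proj M)) !coker_map_funE !bfun_ract.
Qed.

Lemma coker_mapE g : coker_map (coker_proj M g) = coker_proj N (coind_map g).
Proof. exact: coker_map_funE. Qed.

End Functoriality.

(** The cokernel is taken innermost, so that inductions on n replace N by [coker N], as dimension
    shifting does. *)
Fixpoint cosyz n N : bimod A := if n is m.+1 then cosyz m (coker N) else N.

Fixpoint cosyz_map n M N (f : bmor M N) : bmor (cosyz n M) (cosyz n N) :=
  match n return bmor (cosyz n M) (cosyz n N) with
  | 0%N => f
  | m.+1 => cosyz_map m (coker_map f)
  end.

End BimodTheory.

(** * Dimension shifting *)

(* A functor from A-bimodules to B-modules that keeps the underlying space and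
   turns central elements into invariants; it stands for either of the two
   adjoint actions, with B = A or B = A^c. *)
Record ad_functor (k : fieldType) (A B : algType k) := AdFunctor {
  ad_eps : {rmorphism B -> k};
  ad_act : forall N : bimod A, B -> N -> N;
  ad_epsA : forall c, ad_eps c%:A = c;
  ad_actDr : forall (N : bimod A) b, {morph @ad_act N b : x y / x + y};
  ad_actDl : forall (N : bimod A) x, {morph (@ad_act N)^~ x : a b / a + b};
  ad_actM : forall (N : bimod A) a b x,
    @ad_act N (a * b) x = @ad_act N a (@ad_act N b x);
  ad_actA : forall (N : bimod A) c x, @ad_act N c%:A x = c *: x;
  ad_mor : forall (M N : bimod A) (f : bmor M N) a x,
    f (@ad_act M a x) = @ad_act N a (f x);
  ad_central : forall (N : bimod A) (z : N),
    central z <-> forall a, @ad_act N a z = ad_eps a *: z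
}.

(* The argument ad is there for the module structure to be inferred from it. *)
Definition adm (k : fieldType) (A B : algType k) (ad : ad_functor A B)
  (N : bimod A) : Type := N.

Section AdModule.
Variables (k : fieldType) (A B : algType k) (ad : ad_functor A B) (N : bimod A).
Local Notation adm := (adm ad N).

HB.instance Definition _ := GRing.Zmodule.on adm.

Let scale (b : B) (x : adm) : adm := ad_act ad b (x : N).

Let scaleA a b x : scale a (scale b x) = scale (a * b) x.
Proof. by rewrite /scale ad_actM. Qed.
Let scale1 : left_id 1 scale.
Proof. by move=> x; rewrite /scale -(scale1r 1) ad_actA scale1r. Qed.
Let scaleDr : right_distributive scale +%R.
Proof. by move=> a x y; apply: ad_actDr. Qed.
Let scaleDl x : {morph scale^~ x : a b / a + b}.
Proof. by move=> a b; apply: ad_actDl. Qed.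

HB.instance Definition _ := GRing.Zmodule_isLmodule.Build B adm
  scaleA scale1 scaleDr scaleDl.

Lemma adm_scaleE b (x : adm) : b *: x = ad_act ad b (x : N).
Proof. by []. Qed.

End AdModule.

Section Comparison.
Variables (k : fieldType) (A B : algType k) (ad : ad_functor A B).
Implicit Types (M N : bimod A).

Local Notation T := (trivial_module (ad_eps ad) : lmodType B).
Local Notation adm := (adm ad).
Local Notation Y n := (iter n (@syz B) T).

Lemma adm_linear M N (f : bmor M N) : linear (f : adm M -> adm N).
Proof. by move=> b x y; rewrite (linearD f) !adm_scaleE -ad_mor. Qed.

Definition adm_map M N (f : bmor M N) : {linear adm M -> adm N} :=
  mklin (@adm_linear M N f).

Lemma adm_mapE M N (f : bmor M N) x : adm_map f x = f x.
Proof. by []. Qed.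

Lemma trivE (b : B) (c : T) : b *: c = (ad_eps ad b * (c : k)) :> k.
Proof. by []. Qed.

Lemma triv_linear N (f : {linear T -> adm N}) (c : T) :
  (f c : N) = (c : k) *: (f (1 : k) : N).
Proof.
have -> : c = (c : k)%:A *: ((1 : k) : T) by rewrite [RHS]trivE ad_epsA mulr1.
by rewrite linearZ /= adm_scaleE ad_actA trivE ad_epsA mulr1.
Qed.

Lemma triv_central N (f : {linear T -> adm N}) : central (f (1 : k) : N).
Proof.
apply/(ad_central ad) => a; rewrite -adm_scaleE -linearZ /=.
by rewrite [LHS]triv_linear trivE mulr1.
Qed.

Lemma triv_of_central N (z : N) : central z ->
  exists f : {linear T -> adm N}, forall c : T, (f c : N) = (c : k) *: z.
Proof.
move=> /(ad_central ad) zc.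
have fl : linear (fun c : T => (c : k) *: z : adm N).
  move=> b x y; rewrite adm_scaleE [LHS]scalerDl; congr (_ + _).
  rewrite trivE mulrC -scalerA -zc -!(ad_actA ad) -!(ad_actM ad).
  by rewrite -!scalerAl -!scalerAr mul1r mulr1.
by exists (mklin fl).
Qed.

(** Vanishing of Ext^1(X, ad (coind N)) for all X, expressed as extension from the syzygy to the
    free module. *)
Definition coind_acyclic := forall N (X : lmodType B)
  (f : {linear syz X -> adm (coind N)}),
  exists g : {linear free_on X -> adm (coind N)}, forall x, g (syz_val X x) = f x.

Hypothesis acyclic : coind_acyclic.

(* f : Y n -> N represents a class in Ext^n(T, ad N) and z a class in the n-th
   cohomology of the central elements of the coinduced resolution of N; they
   correspond to each other under dimension shifting. *)
Fixpoint dim_shift n N : (Y n -> adm N) -> cosyz n N -> Prop :=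
  match n return (Y n -> adm N) -> cosyz n N -> Prop with
  | 0%N => fun f z => central z /\ forall c : T, (f c : N) = (c : k) *: z
  | m.+1 => fun f z =>
      exists (f' : {linear Y m -> adm (coker N)})
             (g : {linear free_on (Y m) -> adm (coind N)}),
      [/\ dim_shift f' z, forall u, adm_map (coker_proj N) (g u) = f' (free_cover u)
        & forall x, g (syz_val _ x) = adm_map (coind_in N) (f x)]
  end.

Lemma coker_adm_surj N (w : adm (coker N)) : exists v, adm_map (coker_proj N) v = w.
Proof. exact: coker_proj_surj. Qed.

Lemma coker_ker_lift N (X : lmodType B) (g : {linear X -> adm (coind N)}) :
  (forall x, adm_map (coker_proj N) (g x) = 0) ->
  exists f : {linear X -> adm N}, forall x, adm_map (coind_in N) (f x) = g x.
Proof.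
move=> g0.
have ex x : exists n : adm N, adm_map (coind_in N) n = g x.
  by have /coker_proj0 [n nE] := g0 x; exists n; rewrite nE.
have [f fP] := choice ex.
have fl : linear f.
  move=> a x y; apply: (@coind_in_inj _ _ N).
  rewrite -[LHS]/(adm_map (coind_in N) _) -[RHS]/(adm_map (coind_in N) _).
  by rewrite linearP !fP linearP.
by exists (mklin fl).
Qed.

(** By acyclicity f, viewed in the coinduced module, extends to g on the free module; g then induces
    f' on the quotients, one degree lower. *)
Lemma dim_shift_total n N (f : {linear Y n -> adm N}) : exists z, dim_shift f z.
Proof.
elim: n N f => [|n IHn] N f /=.
  exists (f (1 : k)); split; first exact: triv_central.
  by move=> c; apply: triv_linear.
have [g gP] := acyclic (adm_map (coind_in N) \o f : {linear _ -> _}).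
have [|f' f'P] := free_descend (h := adm_map (coker_proj N) \o g : {linear _ -> _}).
  by move=> x /=; rewrite gP /=; apply/coker_proj0; exists (f x).
have [z zP] := IHn _ f'.
by exists z, f', g; split=> // u; rewrite f'P.
Qed.

Lemma dim_shift_central n N f (z : cosyz n N) : dim_shift f z -> central z.
Proof.
elim: n N f z => [|n IHn] N f z /=; first by case.
by case=> f' [g [/IHn]].
Qed.

(** The way back: f' composed with the free cover lifts to g by projectivity, and on the syzygy g
    takes its values in the image of N. *)
Lemma dim_shift_surj n N (z : cosyz n N) : central z ->
  exists f : {linear Y n -> adm N}, dim_shift f z.
Proof.
elim: n N z => [|n IHn] N z zc /=.
  by have [f fP] := triv_of_central zc; exists f.
have [f' f'P] := IHn (coker N) z zc.
pose cov : {linear free_on (Y n) -> Y n} := @free_cover B (Y n).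
have [g gP] := free_lift (f' \o cov : {linear _ -> _}) (@coker_adm_surj N).
have [|f fP] := coker_ker_lift (g := g \o syz_val (Y n) : {linear _ -> _}).
  by move=> x; rewrite /= gP /= free_cover_syz linear0.
by exists f, f', g; split=> // x; apply: esym (fP x).
Qed.

Lemma dim_shiftB n N (f1 f2 : {linear Y n -> adm N}) (z1 z2 : cosyz n N) :
  dim_shift f1 z1 -> dim_shift f2 z2 -> dim_shift (f1 \- f2) (z1 - z2).
Proof.
elim: n N f1 f2 z1 z2 => [|n IHn] N f1 f2 z1 z2 /=.
  move=> [z1c f1P] [z2c f2P]; split; last first.
    by move=> c; rewrite [in RHS]scalerBr -f1P -f2P.
  move=> a; rewrite -scaleN1r !bactD !bactZ.
  by rewrite z1c z2c.
move=> [f1' [g1 [s1 p1 i1]]] [f2' [g2 [s2 p2 i2]]].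
exists (f1' \- f2' : {linear _ -> _}), (g1 \- g2 : {linear _ -> _}); split.
- exact: IHn.
- by move=> u /=; rewrite linearB /= -p1 -p2.
- move=> x; rewrite /= i1 i2.
  exact: esym (linearB (adm_map (coind_in N)) _ _).
Qed.

Lemma dim_shift_map n M N (a : bmor M N) (f : Y n -> adm M) z : dim_shift f z ->
  dim_shift (fun x => adm_map a (f x)) (cosyz_map n a z).
Proof.
elim: n M N a f z => [|n IHn] M N a f z /=.
  move=> [zc fP]; split=> [b|c]; last by rewrite fP linearZ.
  by rewrite -bfun_lact zc bfun_ract.
move=> [f' [g [s p i]]].
exists (adm_map (coker_map a) \o f' : {linear _ -> _}),
       (adm_map (coind_map a) \o g : {linear _ -> _}); split.
- exact: IHn.
- by move=> u; rewrite /= -p; apply: esym (coker_mapE a (g u)).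
- by move=> x; rewrite /= i; apply: (coind_map_in a (f x)).
Qed.

(* The coboundaries of the complex of central elements, in degree n.+1 *)
Fixpoint central_lift n N : cosyz n (coker N) -> Prop :=
  match n return cosyz n (coker N) -> Prop with
  | 0%N => fun z => exists2 c : coind N, central c & coker_proj N c = z
  | m.+1 => fun z => @central_lift m (coker N) z
  end.

Definition central_cob n N : cosyz n N -> Prop :=
  match n return cosyz n N -> Prop with
  | 0%N => fun z => z = 0
  | m.+1 => fun z => @central_lift m N z
  end.

Definition lifts (X : lmodType B) N (f : {linear X -> adm (coker N)}) :=
  exists g : {linear X -> adm (coind N)}, forall x, adm_map (coker_proj N) (g x) = f x.

(** A lift extends to the free module by acyclicity; conversely an extension of f lifts by
    projectivity. *)
Lemma lifts_cob n N (f : {linear Y n.+1 -> adm (coker N)}) :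
  lifts f <-> is_cob n.+1 f.
Proof.
split=> [[g gP]|[h hP]].
  have [g' g'P] := acyclic g.
  exists (adm_map (coker_proj N) \o g' : {linear _ -> _}) => x.
  by rewrite /= g'P gP.
have [g gP] := free_lift h (@coker_adm_surj N).
exists (g \o syz_val (Y n) : {linear _ -> _}) => x.
by rewrite /= gP hP.
Qed.

(** Injectivity of the connecting map. If h extends f, then g minus h kills the syzygy and descends
    to a lift of f'; if l lifts f', then g minus l after the cover has values in N and extends f. *)
Lemma shift_cob n N (f : {linear Y n.+1 -> adm N})
    (f' : {linear Y n -> adm (coker N)})
    (g : {linear free_on (Y n) -> adm (coind N)}) :
  (forall u, adm_map (coker_proj N) (g u) = f' (free_cover u)) ->
  (forall x, g (syz_val _ x) = adm_map (coind_in N) (f x)) ->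
  is_cob n.+1 f <-> lifts f'.
Proof.
move=> gp gi; split=> [[h hP]|[l lP]].
  have [|l lP] := free_descend (h := g \- (adm_map (coind_in N) \o h) : {linear _ -> _}).
    by move=> x; rewrite /= gi hP subrr.
  exists l => x; rewrite -[x]free_coverU -gp lP.
  have e : adm_map (coker_proj N) (adm_map (coind_in N) (h << x >>)) = 0.
    by apply/coker_proj0; exists (h << x >>).
  transitivity (adm_map (coker_proj N) (g << x >> - adm_map (coind_in N) (h << x >>))).
    by [].
  by rewrite linearB [X in _ - X]e subr0.
pose cov : {linear free_on (Y n) -> Y n} := @free_cover B (Y n).
have [|h hP] := coker_ker_lift (g := g \- (l \o cov) : {linear _ -> _}).
  by move=> u; rewrite /= linearB /= gp lP subrr.
exists h => x; apply: (@coind_in_inj _ _ N).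
rewrite -[LHS]/(adm_map (coind_in N) _) -[RHS]/(adm_map (coind_in N) _).
by rewrite hP /= gi free_cover_syz linear0 subr0.
Qed.

Lemma dim_shift_lift n N (f : {linear Y n -> adm (coker N)}) z :
  dim_shift f z -> lifts f <-> central_lift z.
Proof.
elim: n N f z => [|n IHn] N f z /=.
  move=> [zc fP]; split=> [[g gP]|[c cc cz]].
    exists (g (1 : k)); first exact: triv_central.
    by have := gP (1 : k); rewrite fP scale1r.
  have [g gP] := triv_of_central cc; exists g => x.
  by rewrite [RHS]fP -cz -linearZ -gP.
move=> [f' [g [s p i]]]; rewrite lifts_cob (shift_cob p i).
exact: IHn.
Qed.

Lemma dim_shift_cob n N (f : {linear Y n -> adm N}) z :
  dim_shift f z -> is_cob n f <-> central_cob z.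
Proof.
case: n f z => [|n] f z /=.
  move=> [_ fP]; split=> [f0|z0 x]; first by have := fP (1 : k); rewrite f0 scale1r.
  by rewrite [LHS]fP z0 scaler0.
move=> [f' [g [s p i]]]; rewrite -/(is_cob n.+1 f) (shift_cob p i).
exact: dim_shift_lift.
Qed.

End Comparison.

(** * The two adjoint actions *)

Section CoindExtend.
Variables (k : fieldType) (B : algType k) (h : hopf_data B).
Variables (W E : lmodType k) (J : E -> B -> B -> W) (act : B -> E -> E).
Hypothesis J_bilin : forall f, bilin (J f).
Hypothesis J_linear : forall x y, linear (fun f => J f x y).
Hypothesis J_inj : forall f g, (forall x y, J f x y = J g x y) -> f = g.
Hypothesis J_surj : forall F, bilin F -> exists f, forall x y, J f x y = F x y.
Hypothesis J_act : forall b f x y,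
  J (act b f) x y = sw h b (fun p q => J f (x * p) (hS h q * y)).

Lemma coind_actA c f : act c%:A f = c *: f.
Proof.
apply: J_inj => x y; rewrite J_act (linear_scale (J_linear x y)).
have [f1 f2] := J_bilin f.
have b : bilin (fun p q => J f (x * p) (hS h q * y)).
  split=> u a v w; first by rewrite mulrDr -scalerAr (f1 (hS h u * y)).
  by rewrite linearP mulrDl -scalerAl (f2 (x * u)).
by rewrite (linear_scale (sw_linear h b)) sw1 // hS1 mulr1 mul1r.
Qed.

(** With the adjoint action E is coinduced from k: a B-linear f is recovered from the k-linear map p
    |-> f(p)(1, -) by f(p)(x, y) = f(x_1 p)(1, x_2 y), since S(x_2) x_3 collapses. A k-linear
    retraction r onto the syzygy therefore gives the extension g(p)(x, y) = f(r(x_1 p))(1, x_2 y).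
    Evaluation is abstracted as J so that both adjoint actions fit. *)
Lemma coind_extend (X : lmodType B) (f : syz X -> E) :
  (forall b x y, f (b *: x + y) = act b (f x) + f y) ->
  exists2 g : free_on X -> E, forall b x y, g (b *: x + y) = act b (g x) + g y &
    forall x, g (syz_val X x) = f x.
Proof.
move=> fl.
have f0 : f 0 = 0.
  have := fl 1 0 0; rewrite scaler0 addr0 -(scale1r 1) coind_actA scale1r.
  by move=> /(congr1 (fun t => t - f 0)); rewrite subrr addrK.
have fZ b x : f (b *: x) = act b (f x) by rewrite -[in LHS](addr0 (b *: x)) fl f0 addr0.
have vl : linear (fun x : restrict (syz X) => syz_val X x : restrict (free_on X)).
  by move=> c x y; rewrite linearD linearZ.
have [|r rP] := linear_retraction (i := mklin vl); first exact: syz_val_inj.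
have fkl : linear (fun x : restrict (syz X) => f x).
  by move=> c x y; rewrite [LHS]fl coind_actA.
have Kb p : bilin (fun a c : B => J (f (r (a *: p : free_on X))) 1 c).
  split=> [v c a a'|u]; last exact: (J_bilin _).2.
  have -> : ((c *: a + a') *: p : free_on X) =
    c *: (a *: p : restrict (free_on X)) + (a' *: p : restrict (free_on X)).
    rewrite scalerDl; congr (_ + _).
    by rewrite [RHS]scalerA -scalerAl mul1r.
  by rewrite (linearP r) fkl J_linear.
pose K (p : free_on X) (a c : B) : W := J (f (r (a *: p : free_on X))) 1 c.
have Kbil p : bilin (K p) by exact: Kb.
have KZ b p a c : K (b *: p) a c = K p (a * b) c by rewrite /K scalerA.
have KD p q a c : K (p + q) a c = K p a c + K q a c.
  rewrite /K scalerDr (linearD r) -[r _]scale1r fkl scale1r.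
  by have := J_linear 1 c 1 (f (r (a *: p : free_on X))) (f (r (a *: q : free_on X)));
     rewrite !scale1r.
have swb p : bilin (fun x y => sw h x (fun x1 x2 => K p x1 (x2 * y))).
  have [K1 K2] := Kbil p.
  split=> [y|x].
    apply: sw_linear; split=> u c v w; first by rewrite (K1 (u * y)).
    by rewrite mulrDl -scalerAl (K2 u).
  move=> c v w; rewrite /sw scaler_sumr -big_split; apply: eq_bigr => q _ /=.
  by rewrite mulrDr -scalerAr (K2 q.1).
have [g gP] := choice (fun p => J_surj (swb p)).
exists g => [b p p'|p]; apply: J_inj => x y.
  have -> : J (act b (g p) + g p') x y = J (act b (g p)) x y + J (g p') x y.
    by have := J_linear x y 1 (act b (g p)) (g p'); rewrite !scale1r.
  rewrite J_act !gP.
  transitivity (sw h x (fun x1 x2 => K p (x1 * b) (x2 * y)) +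
                sw h x (fun x1 x2 => K p' x1 (x2 * y))).
    by rewrite /sw -big_split; apply: eq_bigr => q _ /=; rewrite KD KZ.
  congr (_ + _).
  have [K1 K2] := Kbil p.
  transitivity (sw h b (fun p1 q => sw h x (fun x1 x2 => sw h p1 (fun u v =>
      K p (x1 * u) (x2 * v * (hS h q * y)))))); last first.
    apply: eq_sw => p1 q; rewrite gP swM //.
    split=> u c v w; first by rewrite (K1 (u * (hS h q * y))).
    by rewrite mulrDl -scalerAl (K2 u).
  rewrite sw_exchange; apply: eq_sw => x1 x2.
  rewrite sw_assoc; last first.
    split=> u v c a a'.
    - by rewrite mulrDr -scalerAr (K1 (x2 * u * (hS h v * y))).
    - by rewrite mulrDr -scalerAr mulrDl -scalerAl (K2 (x1 * u)).
    - by rewrite linearP mulrDl -scalerAl mulrDr -scalerAr (K2 (x1 * u)).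
  transitivity (sw h b (fun a c => sw h c (fun v q =>
      K p (x1 * a) (x2 * (v * hS h q) * y)))); last first.
    by do 2!apply: eq_sw => ? ?; rewrite !mulrA.
  rewrite (sw_contract_r (sw_Sr h) (G := fun a t => K p (x1 * a) (x2 * t * y))).
    by rewrite mulr1.
  split=> u c v w; first by rewrite mulrDr -scalerAr (K1 (x2 * u * y)).
  by rewrite mulrDr -scalerAr mulrDl -scalerAl (K2 (x1 * u)).
have [F1 F2] := J_bilin (f p).
rewrite gP.
transitivity (sw h x (fun x1 x2 => sw h x1 (fun u v =>
    J (f p) u (hS h v * x2 * y)))).
  apply: eq_sw => x1 x2; rewrite /K -linearZ (rP (x1 *: p)) fZ J_act.
  by apply: eq_sw => u v; rewrite mul1r mulrA.
rewrite sw_assoc; last first.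
  split=> u v c a a'.
  - by rewrite (F1 (hS h u * v * y)).
  - by rewrite linearP !mulrDl -!scalerAl (F2 u).
  - by rewrite mulrDr -scalerAr mulrDl -scalerAl (F2 u).
rewrite (sw_contract_r (sw_Sl h) (G := fun a t => J (f p) a (t * y))) ?mul1r //.
split=> u c v w; first by rewrite (F1 (u * y)).
by rewrite mulrDl -scalerAl (F2 u).
Qed.

End CoindExtend.

Section AdLeft.
Variables (k : fieldType) (A : algType k) (h : hopf_data A).
Variables (eps : {rmorphism A -> k}) (epsE : forall a, eps a = heps h a).
Implicit Types (N : bimod A).

Definition ad_left_act N (a : A) (n : N) : N :=
  sw h a (fun p q => lact p (ract (hS h q) n)).

Let bl N (n : N) : bilin (fun p q => lact p (ract (hS h q) n)).
Proof. by split=> u c v w; rewrite ?linearP !bactD !bactZ. Qed.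

Lemma ad_left_epsA c : eps c%:A = c.
Proof. by rewrite epsE linearZ /= heps1 [LHS]mulr1. Qed.

Lemma ad_left_actDr N a : {morph @ad_left_act N a : x y / x + y}.
Proof.
by move=> x y; rewrite /ad_left_act /sw -big_split; apply: eq_bigr => p _; rewrite !bactD.
Qed.

Lemma ad_left_actDl N x : {morph (@ad_left_act N)^~ x : a b / a + b}.
Proof. by move=> a b; have := sw_linear h (bl x) 1 a b; rewrite !scale1r. Qed.

Lemma ad_left_actM N a b (x : N) :
  ad_left_act (a * b) x = ad_left_act a (ad_left_act b x).
Proof.
rewrite /ad_left_act swM //; apply: eq_sw => p q.
rewrite (sw_lin _ _ (g := fun t => lact p (ract (hS h q) t))); last first.
  by move=> c u v; rewrite !bactD !bactZ.
by apply: eq_sw => p' q'; rewrite hSM lactM ractM !lractC.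
Qed.

Lemma ad_left_actA N c (x : N) : ad_left_act c%:A x = c *: x.
Proof.
rewrite /ad_left_act (linear_scale (sw_linear h (bl x))) sw1 //.
by rewrite hS1 lact1 ract1.
Qed.

Lemma ad_left_mor (M N : bimod A) (f : bmor M N) a x :
  f (ad_left_act a x) = ad_left_act a (f x).
Proof. by rewrite linear_sw; apply: eq_sw => p q; rewrite bfun_lact bfun_ract. Qed.

Lemma ad_left_central N (z : N) :
  central z <-> forall a, ad_left_act a z = eps a *: z.
Proof.
split=> [zc a|zi a].
  transitivity (sw h a (fun p q => ract (p * hS h q) z)).
    by apply: eq_sw => p q; rewrite lractC zc -ractM.
  rewrite -(sw_lin _ _ (g := fun t => ract t z)); last exact: (ract_bilin N).1.
  by rewrite sw_Sr ractZl ract1 epsE.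
(* An invariant z is central because a z = a_1 z S(a_2) a_3, which is the adjoint action of a_1
   followed by a_2 on the right. *)
transitivity (sw h a (fun b c => sw h b (fun p q => lact p (ract (hS h q * c) z)))).
  rewrite sw_assoc; last first.
    split=> ? ? ? ? ?; rewrite ?linearP ?mulrDl ?mulrDr -?scalerAl -?scalerAr;
      by rewrite !bactD !bactZ.
  rewrite (sw_contract_r (sw_Sl h) (G := fun p t => lact p (ract t z))) ?ract1 //.
  by split=> ? ? ? ?; rewrite !bactD !bactZ.
transitivity (sw h a (fun b c => ract c (ad_left_act b z))).
  apply: eq_sw => b c; rewrite /ad_left_act.
  rewrite (sw_lin _ _ (g := ract c)); last exact: (ract_bilin N).2.
  by apply: eq_sw => p q; rewrite ractM lractC.
transitivity (sw h a (fun b c => heps h b *: ract c z)).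
  by apply: eq_sw => b c; rewrite zi ractZr epsE.
exact: (sw_epsl h a ((ract_bilin N).1 z)).
Qed.

Definition ad_left : ad_functor A A :=
  AdFunctor ad_left_epsA ad_left_actDr ad_left_actDl ad_left_actM ad_left_actA
    ad_left_mor ad_left_central.

Lemma ad_left_acyclic : coind_acyclic ad_left.
Proof.
move=> N X f.
have [||||b g x y|b x y|g gl gP] := @coind_extend _ _ h N (coind N) (@coind_fun _ _ N)
    (@ad_left_act (coind N)) _ _ _ _ _ X f.
- exact: coind_bilin.
- by move=> x y c g g'; rewrite coind_funP.
- exact: coind_ext.
- by move=> F Fb; exists (mk_coind Fb).
- rewrite /ad_left_act.
  have el : linear (fun g : coind N => coind_fun g x y).
    by move=> c g1 g2; rewrite coind_funP.
  by rewrite (sw_lin h _ _ el).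
- exact: (linearP f).
have gl' : linear (g : free_on X -> adm ad_left (coind N)) by [].
by exists (mklin gl').
Qed.

End AdLeft.

Program Definition bop (k : fieldType) (A : algType k) (N : bimod A) : bimod A^c :=
  @Bimod k A^c N (@ract _ _ N) (@lact _ _ N) _ _ _ _ _ _ _.
Next Obligation. by move=> k A N; apply: ract_bilin. Qed.
Next Obligation. by move=> k A N; apply: lact_bilin. Qed.
Next Obligation. by move=> k A N; apply: ract1. Qed.
Next Obligation. by move=> k A N; apply: lact1. Qed.
Next Obligation. by move=> k A N a b x; exact: (@ractM _ _ N b a x). Qed.
Next Obligation. by move=> k A N a b x; exact: (@lactM _ _ N b a x). Qed.
Next Obligation. by move=> k A N a b x; rewrite lractC. Qed.

Program Definition bop_mor (k : fieldType) (A : algType k) (M N : bimod A)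
  (f : bmor M N) : bmor (bop M) (bop N) := @Bmor _ _ (bop M) (bop N) f _ _.
Next Obligation. by move=> k A M N f a x; exact: (bfun_ract f a x). Qed.
Next Obligation. by move=> k A M N f a x; exact: (bfun_lact f a x). Qed.

Section AdRight.
Variables (k : fieldType) (A : algType k) (h : hopf_data A).
Variables (eps : {rmorphism A^c -> k}) (epsE : forall a : A, eps a = heps h a).

Let adl := ad_left (h := opcop h) epsE.

Lemma ad_right_mor (M N : bimod A) (f : bmor M N) a x :
  f (ad_act adl a (x : bop M)) = ad_act adl a (f x : bop N).
Proof. exact: (ad_mor adl (bop_mor f)). Qed.

Lemma ad_right_central (N : bimod A) (z : N) :
  central z <-> forall a, ad_act adl a (z : bop N) = eps a *: z.
Proof.
rewrite -(ad_central adl (z : bop N)).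
by split=> zc a; apply: esym (zc a).
Qed.

(** The right adjoint action n |-> S(a_1) n a_2, obtained as the left adjoint action of the
    opposite, co-opposite Hopf algebra on N with its sides exchanged. *)
Definition ad_right : ad_functor A A^c :=
  @AdFunctor k A A^c eps (fun N => @ad_act _ _ _ adl (bop N))
    (ad_epsA adl) (fun N => @ad_actDr _ _ _ adl (bop N))
    (fun N => @ad_actDl _ _ _ adl (bop N)) (fun N => @ad_actM _ _ _ adl (bop N))
    (fun N => @ad_actA _ _ _ adl (bop N)) ad_right_mor ad_right_central.

Lemma ad_right_acyclic : coind_acyclic ad_right.
Proof.
move=> N X f.
have [g|x y c g g'|g g' gg'|F [F1 F2]|b g x y|b x y|g gl gP] :=
    @coind_extend _ _ (opcop h) N (coind N)
    (* The arguments are exchanged because left multiplication in [A^c] concerns the right-hand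
       variable of the coinduced bimodule. *)
    (fun g x y => coind_fun g y x) (@ad_act _ _ _ ad_right (coind N)) _ _ _ _ _ X f.
- by have [g1 g2] := coind_bilin g; split.
- by rewrite coind_funP.
- by apply: coind_ext.
- have Fb : bilin (fun x y : A => F y x : N) by split.
  by exists (mk_coind Fb).
- have el : linear (fun g : coind N => coind_fun g y x).
    by move=> c g1 g2; rewrite coind_funP.
  have := (sw_lin (opcop h) b
    (fun p q => @lact _ _ (bop (coind N)) p
       (ract (hS (opcop h) q) (g : bop (coind N)))) el).
  by move=> e; exact: e.
- exact: (linearP f).
have gl' : linear (g : free_on X -> adm ad_right (coind N)) by [].
by exists (mklin gl').
Qed.

End AdRight.

(** * Ext in terms of syzygies *)

Section ExtSyzygy.
Variables (k : fieldType) (A : algType k) (T N : lmodType A) (n : nat).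

Local Notation Y := (iter n (@syz A) T).
Let cov : {linear free_on Y -> Y} := @free_cover A Y.

Lemma hom_linear (M : lmodType A) (f : hom M N) : linear (val f : M -> N).
Proof. exact/asboolP/(valP f). Qed.

Definition mk_hom (M : lmodType A) (f : {linear M -> N}) : hom M N :=
  Sub (f : M -> restrict N) (introT (asboolP _) (linearP f)).

Lemma cov_cocycle (f : hom Y N) :
  precomp cov f \in kernel (precomp (N := N) (free_res_diff T n)).
Proof.
apply/eqP; apply: val_inj; apply: funext => x /=.
have -> : cov (free_res_diff T n x) = 0 by apply/free_diff_exact; exists x.
exact: (linear0 (mklin (hom_linear f))).
Qed.

Definition syz_cocycle (f : hom Y N) : cocycle (free_res_diff T) N n :=
  Sub (precomp cov f) (cov_cocycle f).

Definition ext_class (f : hom Y N) : Ext n T N := quotmod_pi _ (syz_cocycle f).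

Lemma ext_class_linear : linear ext_class.
Proof.
move=> c f g; rewrite /ext_class -linearP; congr (quotmod_pi _ _).
by apply: val_inj; apply: (linearP (precomp (N := N) cov)).
Qed.

(** A cocycle kills the image of the differential, which is the kernel of the free cover, so it
    descends to the syzygy. *)
Lemma ext_class_surj (v : Ext n T N) : exists f, ext_class f = v.
Proof.
have [c cv] : exists c : cocycle (free_res_diff T) N n, quotmod_pi _ c = v.
  by exists (repr v); apply: quotmod_repr.
have [|f fP] := free_descend (h := mklin (hom_linear (val c)) : {linear free_on Y -> N}).
  move=> x; have [y ->] : exists y, syz_val Y x = free_res_diff T n y.
    by apply/free_diff_exact/free_cover_syz.
  by have /eqP /(congr1 (fun f => val f y)) := valP c.
exists (mk_hom f); rewrite -cv; congr (quotmod_pi _ _).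
do 2!apply: val_inj; apply: funext => u /=; exact: fP.
Qed.

End ExtSyzygy.

Lemma ext_class0 (k : fieldType) (A : algType k) (T N : lmodType A) n
    (f : hom (iter n (@syz A) T) N) :
  ext_class f = 0 <-> is_cob n (val f : iter n (@syz A) T -> N).
Proof.
have -> : ext_class f = 0 <-> is_coboundary (syz_cocycle f).
  rewrite /ext_class.
  set S := submod_of _.
  have -> : (0 : Ext n T N) = quotmod_pi S 0 by rewrite linear0.
  by split=> [/quotmod_piP|fc]; last (apply/quotmod_piP); rewrite subr0.
case: n f => [|n] f /=.
  split=> [/eqP/(congr1 (fun g => val (val g)))/= f0 x|f0].
    by have := congr1 (fun g => g << x >>) f0; rewrite /= free_coverU.
  by apply/eqP; do 2!apply: val_inj; apply: funext => u /=; apply: f0.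
split=> [/asboolP [g fg]|[g fg]].
  exists (mklin (hom_linear g)) => x; rewrite -[x in LHS]free_coverU.
  have := congr1 (fun g => val g << x >>) fg; rewrite /= => ->.
  by rewrite /free_diff free_coverU.
apply/asboolP; exists (mk_hom g); apply: val_inj; apply: funext => u /=.
exact: fg.
Qed.

Lemma ext_dim1 (k : fieldType) (A : algType k) (T : lmodType A) n :
  has_dim (Ext n T (A^o : lmodType A)) 1 ->
  exists e : {linear iter n (@syz A) T -> A^o}, ~ is_cob n e /\
    forall f : {linear iter n (@syz A) T -> A^o}, exists c : k,
      is_cob n (fun x => f x - c *: (e x : A) : A^o).
Proof.
move=> [b bP]; have [e eb] := ext_class_surj (b ord0).
exists (mklin (hom_linear e)); split=> [/(ext_class0 e) e0|f].
  (* If e were a coboundary the basis vector would vanish, and 0 would have both 1 and 0 as its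
     coordinate. *)
  have [c [_ cU]] := bP 0.
  have bc (c' : 'rV[k]_1) : 0 = \sum_(i < 1) c' 0 i *: b i.
    by rewrite big_ord1 -eb e0 scaler0.
  have /rowP /(_ 0) := etrans (esym (cU (const_mx 1) (bc _))) (cU 0 (bc _)).
  by rewrite !mxE => /eqP; rewrite oner_eq0.
have [c [cE _]] := bP (ext_class (mk_hom f)).
exists (c 0 0); move: cE; rewrite big_ord1 -eb => cE.
have /ext_class0 : ext_class ((- c 0 0) *: e + mk_hom f) = 0.
  by rewrite ext_class_linear cE scaleNr addNr.
apply: cob_ext => x; rewrite /= addrC -scaleNr; congr (_ + _).
transitivity ((- c 0 0)%:A * (sval e x : A)); first by [].
by rewrite -scalerAl mul1r.
Qed.

(** * Ext from the trivial module to the adjoint module of a tensor square *)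

Section Half.
Variables (k : fieldType) (A B : algType k) (ad : ad_functor A B).
Variables (h : hopf_data B) (M : bimod A) (tau : B -> B -> M) (d : nat).
Local Notation S := (hS h).
Local Notation T := (trivial_module (ad_eps ad) : lmodType B).
Local Notation Y := (iter d (@syz B) T).
Local Notation adM := (adm ad M).

(** The pair M, [tau] is a tensor square of B, described by generation and lifting so that the same
    section serves H and, with the factors exchanged, [H^c]. *)
Hypothesis tau_bilin : bilin tau.
Hypothesis tau_span : forall m, exists s : seq (B * B), m = \sum_(p <- s) tau p.1 p.2.
Hypothesis tau_lift : forall (W : lmodType k) (F : B -> B -> W), bilin F ->
  exists L : {linear M -> W}, forall x y, L (tau x y) = F x y.
Hypothesis tau_act : forall b x y,
  ad_act ad b (tau x y) = sw h b (fun p q => tau (p * x) (y * S q)).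

Let tau1 := tau_bilin.1.
Let tau2 := tau_bilin.2.

(* The isomorphism of B (x) B, with B acting on the first factor, onto ad M. *)
Definition untwist (x y : B) : M := sw h x (fun p q => tau p (y * S q)).

Let untwist_inner y : bilin (fun p q => tau p (y * S q)).
Proof.
by split=> u c v w; rewrite ?(tau1 (y * S u)) // linearP mulrDr -scalerAr (tau2 u).
Qed.

Lemma untwist_bilin : bilin untwist.
Proof.
split=> [y|x]; first exact: sw_linear.
move=> c y y'; rewrite /untwist /sw scaler_sumr -big_split; apply: eq_bigr => p _ /=.
by rewrite mulrDl -scalerAl (tau2 p.1).
Qed.

Lemma untwist_act b x y : untwist (b * x) y = ad_act ad b (untwist x y).
Proof.
have al : linear (ad_act ad b : M -> M).
  move=> c m m'; rewrite ad_actDr; congr (_ + _).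
  rewrite -!(ad_actA ad) -!ad_actM; congr (ad_act ad _ m).
  by rewrite -scalerAr -scalerAl mulr1 mul1r.
rewrite /untwist swM // (sw_lin _ _ _ al) sw_exchange; apply: eq_sw => p q.
by rewrite tau_act; apply: eq_sw => p' q'; rewrite hSM mulrA.
Qed.

Lemma untwist_linear y : linear (fun x : B^o => untwist x y : adM).
Proof.
move=> b x x'; rewrite adm_scaleE -untwist_act.
by have := untwist_bilin.1 y 1 (b * x) x'; rewrite /= !scale1r.
Qed.

(** The map id (x) l after the inverse untwisting. It is B-linear from ad M to B, so it carries
    cocycles with values in M to cocycles with values in B. *)
Lemma functional_transfer (l : {linear B -> k^o}) :
  exists L : {linear M -> B}, forall x y,
    L (tau x y) = sw h x (fun p q => l (y * S (S q)) *: p).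
Proof.
apply: tau_lift; split=> [y|x].
  apply: sw_linear; split=> u c v w.
    by rewrite scalerDr !scalerA mulrC.
  by rewrite !linearP mulrDr -scalerAr linearP scalerDl scalerA.
move=> c y y'; rewrite /sw scaler_sumr -big_split; apply: eq_bigr => p _ /=.
by rewrite mulrDl -scalerAl linearP scalerDl scalerA.
Qed.

Definition fun_transfer l : {linear M -> B} := sval (cid (functional_transfer l)).

Lemma fun_transferE l x y :
  fun_transfer l (tau x y) = sw h x (fun p q => l (y * S (S q)) *: p).
Proof. by rewrite /fun_transfer; case: cid. Qed.

Lemma fun_transfer_act l b m :
  fun_transfer l (ad_act ad b m) = b * fun_transfer l m.
Proof.
have [s ->] := tau_span m; elim: s => [|[x y] s IHs].
  rewrite big_nil linear0 mulr0.
  suff -> : ad_act ad b 0 = 0 :> M by rewrite linear0.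
  by apply: (@addIr _ (ad_act ad b (0 : M))); rewrite -ad_actDr !add0r.
rewrite big_cons /= ad_actDr !linearD mulrDr IHs /=; congr (_ + _).
rewrite tau_act linear_sw fun_transferE.
rewrite (sw_lin _ _ (g := fun t => b * t)); last by lin.
transitivity (sw h b (fun p q => sw h x (fun p' q' => sw h p (fun u v =>
    l (y * (S q * S (S v)) * S (S q')) *: (u * p'))))).
  apply: eq_sw => p q; rewrite fun_transferE swM.
    rewrite sw_exchange; apply: eq_sw => p' q'; apply: eq_sw => u v.
    by rewrite !hSM !mulrA.
  split=> u c v w; first by rewrite scalerDr !scalerA mulrC.
  by rewrite !linearP mulrDr -scalerAr linearP scalerDl scalerA.
rewrite sw_exchange; apply: eq_sw => p' q'.
rewrite sw_assoc; last first.
  split=> u v c w w'.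
  - by rewrite mulrDl -scalerAl scalerDr !scalerA mulrC.
  - rewrite 2!linearP mulrDr -scalerAr mulrDr -scalerAr mulrDl -scalerAl.
    by rewrite linearP scalerDl scalerA.
  - rewrite linearP mulrDl -scalerAl mulrDr -scalerAr mulrDl -scalerAl.
    by rewrite linearP scalerDl scalerA.
(* The factor S(b_3) S^2(b_2) collapses and leaves b_1, which gives B-linearity. *)
rewrite (sw_contract_r (sw_SSl h)
  (G := fun a t => l (y * t * S (S q')) *: (a * p'))) ?mulr1 -?scalerAr //.
split=> u c v w; first by rewrite mulrDl -scalerAl scalerDr !scalerA mulrC.
by rewrite mulrDr -scalerAr mulrDl -scalerAl linearP scalerDl scalerA.
Qed.

Lemma fun_transfer_untwist l x y : fun_transfer l (untwist x y) = l y *: x.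
Proof.
rewrite /untwist linear_sw.
transitivity (sw h x (fun p q => sw h p (fun u v =>
    l (y * (S q * S (S v))) *: u))).
  by apply: eq_sw => p q; rewrite fun_transferE; apply: eq_sw => u v; rewrite mulrA.
rewrite sw_assoc; last first.
  split=> u v c w w'.
  - by rewrite scalerDr !scalerA mulrC.
  - by rewrite 2!linearP mulrDr -scalerAr mulrDr -scalerAr linearP scalerDl scalerA.
  - by rewrite linearP mulrDl -scalerAl mulrDr -scalerAr linearP scalerDl scalerA.
rewrite (sw_contract_r (sw_SSl h) (G := fun a t => l (y * t) *: a)) ?mulr1 //.
split=> u c v w; first by rewrite scalerDr !scalerA mulrC.
by rewrite mulrDr -scalerAr linearP scalerDl scalerA.
Qed.

Lemma untwist_surj x y : sw h x (fun p q => untwist p (y * S (S q))) = tau x y.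
Proof.
transitivity (sw h x (fun p q => sw h p (fun u v => tau u (y * (S (S q) * S v))))).
  by do 2!apply: eq_sw => ? ?; rewrite mulrA.
rewrite sw_assoc; last first.
  split=> u v c w w'; rewrite ?(tau1 (y * (S (S v) * S u))) //.
    by rewrite linearP !mulrDr -!scalerAr (tau2 u).
  by rewrite !linearP mulrDl mulrDr -scalerAl -scalerAr (tau2 u).
rewrite (sw_contract_r (sw_SSr h) (G := fun a t => tau a (y * t))) ?mulr1 //.
split=> u c v w; first by rewrite (tau1 (y * u)).
by rewrite mulrDr -scalerAr (tau2 u).
Qed.

(** In untwisted coordinates this is id (x) q, with q the finite-rank operator given by b: a
    B-linear approximation of the identity of ad M. *)
Definition recombine (b : seq ({linear B -> k^o} * B)) (m : M) : M :=
  \sum_(p <- b) untwist (fun_transfer p.1 m) p.2.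

Lemma recombine_linear b : linear (recombine b : adM -> adM).
Proof.
move=> a m m'; rewrite /recombine [in RHS]scaler_sumr -big_split.
apply: eq_bigr => p _ /=.
rewrite -(untwist_linear p.2) linearD; congr (untwist (_ + _) _).
exact: fun_transfer_act.
Qed.

Lemma recombineD b m m' : recombine b (m + m') = recombine b m + recombine b m'.
Proof. exact: (linearD (mklin (@recombine_linear b)) (m : adM) m'). Qed.

(** The list collects the second tensor factors of m in untwisted coordinates. It is chosen before b
    so that lists for several m can be concatenated and treated by a single b. *)
Lemma recombine_id m : exists s : seq B, forall b : seq ({linear B -> k^o} * B),
  (forall x, x \in s -> x = \sum_(p <- b) p.1 x *: p.2) -> recombine b m = m.
Proof.
have [t ->] := tau_span m; elim: t => [|[x y] t [s sP]].
  exists [::] => b _; rewrite big_nil; exact: (linear0 (mklin (@recombine_linear b))).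
exists ([seq y * S (S q.2) | q <- hD h x] ++ s) => b bP; rewrite big_cons.
rewrite recombineD; congr (_ + _); last first.
  by apply: sP => z zs; apply: bP; rewrite mem_cat zs orbT.
rewrite /recombine -[RHS]untwist_surj.
transitivity (\sum_(p <- b) sw h x (fun u v =>
    p.1 (y * S (S v)) *: untwist u p.2)).
  apply: eq_bigr => p _; rewrite fun_transferE (sw_lin _ _ _ (untwist_bilin.1 p.2)).
  by apply: eq_sw => u v; rewrite (linear_scale (untwist_bilin.1 p.2)).
rewrite /sw exchange_big /=; apply: eq_big_seq => q qx.
rewrite [in RHS](bP (y * S (S q.2))); last first.
  by rewrite mem_cat; apply/orP; left; apply/mapP; exists q.
rewrite (linear_fun_sum (untwist_bilin.2 q.1)); apply: eq_bigr => p _.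
by rewrite (linear_scale (untwist_bilin.2 q.1)).
Qed.

Lemma recombine_id_seq (s : seq M) : exists b, forall m, m \in s -> recombine b m = m.
Proof.
suff [t tP] : exists t : seq B, forall b : seq ({linear B -> k^o} * B),
  (forall x, x \in t -> x = \sum_(p <- b) p.1 x *: p.2) ->
  forall m, m \in s -> recombine b m = m.
  by have [b bP] := finite_projection t; exists b; apply: tP.
elim: s => [|m s [t tP]]; first by exists [::].
have [u uP] := recombine_id m; exists (u ++ t) => b bP m'.
rewrite inE => /orP [/eqP ->|m's].
  by apply: uP => x xu; apply: bP; rewrite mem_cat xu.
by apply: tP => // x xt; apply: bP; rewrite mem_cat xt orbT.
Qed.

(** * Ext with values in the tensor square, as a copy of B *)

Hypothesis Bn : left_noetherian B.
Variable e : {linear Y -> B^o}.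
Hypothesis e_ncob : ~ is_cob d e.
Hypothesis e_gen : forall f : {linear Y -> B^o}, exists c : k,
  is_cob d (fun x => f x - c *: (e x : B) : B^o).

Lemma ext_rep_linear y : linear (fun p => untwist (e p) y : adM).
Proof. by move=> a p q; rewrite linearP untwist_linear. Qed.

Definition ext_rep y : {linear Y -> adM} := mklin (@ext_rep_linear y).

Lemma ext_repE y p : ext_rep y p = untwist (e p) y.
Proof. by []. Qed.

Lemma ext_repB y y' p : ext_rep (y - y') p = ext_rep y p - ext_rep y' p.
Proof.
rewrite !ext_repE [y - y']addrC [RHS]addrC.
by have := untwist_bilin.2 (e p) (-1) y' y; rewrite !scaleN1r.
Qed.

Lemma triv_fin_gen : fin_gen T.
Proof.
exists [:: (1 : k) : T] => x /=; exists (x : k)%:A.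
by rewrite trivE ad_epsA mulr1 subrr.
Qed.

Lemma fun_transfer_linear l : linear (fun_transfer l : adM -> B^o).
Proof. by move=> a m m'; rewrite linearD /= fun_transfer_act. Qed.

(** Up to coboundary f factors through a finitely generated O, so one finite-rank P fixes all
    relevant values. Then f is cohomologous to P f, whose components are cocycles with values in B,
    hence scalar multiples of e. *)
Lemma ext_rep_surj (f : {linear Y -> adM}) :
  exists y, is_cob d (fun p => f p - ext_rep y p).
Proof.
have [O [p [i [[s sO] apx]]]] := fin_gen_approx Bn d triv_fin_gen.
have [b bP] := recombine_id_seq (map (f \o i) s).
pose P : {linear adM -> adM} := mklin (@recombine_linear b).
have PO w : P (f (i w)) = f (i w).
  have : gen s w := sO w.
  elim: s {sO} w bP => [|g s IHs] w bP.
    by move=> ->; rewrite (linear0 i) (linear0 f) (linear0 P).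
  case=> a wa; rewrite -[w](subrK (a *: g)) addrC (linearP i) (linearP f).
  rewrite (linearP P) (IHs (w - a *: g)) //; last first.
    by move=> m ms; apply: bP; rewrite inE ms orbT.
  by congr (_ *: _ + _); apply: bP; rewrite inE eqxx.
have [c cP] := choice (fun l =>
  e_gen (mklin (fun_transfer_linear l) \o f : {linear _ -> _})).
exists (\sum_(q <- b) c q.1 *: q.2).
(* With g = f - f i p a coboundary, f - P f = g - P g because P fixes f i p. *)
have cob1 : is_cob d (fun x => f x - P (f x)).
  apply: (cob_ext _ (cobB (apx _ f) (cob_comp P (apx _ f)))) => x.
  by rewrite (linearB P) PO opprB addrA subrK.
have cob2 : is_cob d (fun x => \sum_(q <- b)
    (untwist ((fun_transfer q.1 (f x) : B) - c q.1 *: (e x : B)) q.2 : adM)).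
  apply: cob_sum => q.
  exact: (cob_comp (mklin (@untwist_linear q.2)) (cP q.1)).
apply: (cob_ext _ (cobD cob1 cob2)) => x.
have -> : ext_rep (\sum_(q <- b) c q.1 *: q.2) x =
    \sum_(q <- b) (c q.1 *: untwist (e x) q.2 : M).
  rewrite ext_repE (linear_fun_sum (untwist_bilin.2 (e x))).
  by apply: eq_bigr => q _; rewrite (linear_scale (untwist_bilin.2 (e x))).
have -> : \sum_(q <- b) (untwist ((fun_transfer q.1 (f x) : B) -
      c q.1 *: (e x : B)) q.2 : adM) =
    P (f x) - \sum_(q <- b) (c q.1 *: untwist (e x) q.2 : M).
  rewrite [P _]/(recombine b (f x)) /recombine -sumrB; apply: eq_bigr => q _.
  rewrite [_ - c q.1 *: (e x : B)]addrC [RHS]addrC.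
  have := untwist_bilin.1 q.2 (- c q.1) (e x) (fun_transfer q.1 (f x)).
  by rewrite !scaleNr.
by rewrite addrA subrK.
Qed.

(** For y nonzero, a functional with value 1 at y transfers to a B-linear map that sends the cocycle
    back to e. *)
Lemma ext_rep_inj y : is_cob d (ext_rep y) -> y = 0.
Proof.
move=> cy; apply/eqP; apply: contrapT => /negP y0.
have [l ly] := exists_functional y0; apply: e_ncob.
apply: (cob_ext _ (cob_comp (mklin (fun_transfer_linear l)) cy)) => x.
by rewrite /mklin /= fun_transfer_untwist ly scale1r.
Qed.

Lemma cob_scale (N : lmodType B) (f : Y -> N) (c : B) :
  (forall b, c * b = b * c) -> is_cob d f -> is_cob d (fun x => c *: f x).
Proof.
move=> cc; have cl : linear (fun x : N => c *: x).
  by move=> b x y; rewrite scalerDr !scalerA cc.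
exact: (cob_comp (mklin cl)).
Qed.

Lemma cob_unique c : is_cob d (fun x => c *: (e x : B) : B^o) -> c = 0.
Proof.
move=> cc; apply/eqP; apply: contrapT => /negP c0; apply: e_ncob.
have central_c b : (c^-1)%:A * b = b * (c^-1)%:A :> B.
  by rewrite -scalerAl -scalerAr mul1r mulr1.
apply: (cob_ext _ (cob_scale central_c cc)) => x.
rewrite [LHS](_ : _ = (c^-1)%:A * (c *: (e x : B))) //.
by rewrite -scalerAl mul1r scalerA mulVf // scale1r.
Qed.

(** * The character on the generator and the map nu *)

Lemma ext_mul_linear s : linear (fun p => (e p : B) * s : B^o).
Proof. by move=> a p q; rewrite linearP mulrDl -[X in X + _]mulrA. Qed.

Definition ext_char (s : B) : k := sval (cid (e_gen (mklin (ext_mul_linear s)))).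

Lemma ext_charP s : is_cob d (fun p => (e p : B) * s - ext_char s *: (e p : B) : B^o).
Proof. exact: (svalP (cid (e_gen (mklin (ext_mul_linear s))))). Qed.

Lemma ext_char_unique s c :
  is_cob d (fun p => (e p : B) * s - c *: (e p : B) : B^o) -> ext_char s = c.
Proof.
move=> sc; apply/eqP; rewrite -subr_eq0; apply/eqP/cob_unique.
apply: (cob_ext _ (cobB sc (ext_charP s))) => x.
by rewrite opprB addrC addrA subrK scalerBl.
Qed.

Lemma ext_char_linear : linear (ext_char : B -> k^o).
Proof.
move=> c s t; apply: ext_char_unique.
have central_c b : c%:A * b = b * c%:A :> B by rewrite -scalerAl -scalerAr mul1r mulr1.
apply: (cob_ext _ (cobD (cob_scale central_c (ext_charP s)) (ext_charP t))) => x.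
rewrite [X in X + _](_ : _ = c%:A * ((e x : B) * s - ext_char s *: (e x : B))) //.
rewrite -scalerAl mul1r scalerBr mulrDr -scalerAr scalerDl -scalerA opprD.
exact: addrACA.
Qed.

Lemma ext_char1 : ext_char 1 = 1.
Proof.
apply: ext_char_unique; apply: (cob_ext _ (cob0 _ _ _)) => x.
by rewrite mulr1 scale1r subrr.
Qed.

Lemma ext_charM s t : ext_char (s * t) = ext_char s * ext_char t.
Proof.
apply: ext_char_unique.
have ml : linear (fun b : B^o => (b : B) * t : B^o).
  by move=> a p q; rewrite mulrDl -[X in X + _]mulrA.
have central_c b : (ext_char s)%:A * b = b * (ext_char s)%:A :> B.
  by rewrite -scalerAl -scalerAr mul1r mulr1.
apply: (cob_ext _ (cobD (cob_comp (mklin ml) (ext_charP s))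
  (cob_scale central_c (ext_charP t)))) => x.
rewrite /mklin /= [X in _ + X](_ : _ = (ext_char s)%:A *
   ((e x : B) * t - ext_char t *: (e x : B))) //.
rewrite -scalerAl mul1r mulrBl scalerBr scalerA mulrA addrA.
by rewrite -scalerAl subrK.
Qed.

Definition winding (s : B) : B := sw h s (fun a b => ext_char a *: b).
Definition nakayama (s : B) : B := S (S (winding s)).

Lemma nakayama_sw s : nakayama s = sw h s (fun a b => ext_char a *: S (S b)).
Proof.
by rewrite /nakayama !linear_sw; apply: eq_sw => a b; rewrite !linearZ.
Qed.

(** Here S^2 enters: in untwisted coordinates x (x) y |-> x s (x) t y becomes x (x) y |-> x s_1 (x)
    t y S^2(s_2), because S^2(s_3) S(s_2) collapses. *)
Lemma untwist_mul (f : M -> M) s t x y : linear f ->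
  (forall u v, f (tau u v) = tau (u * s) (t * v)) ->
  f (untwist x y) = sw h s (fun a b => untwist (x * a) (t * y * S (S b))).
Proof.
move=> fl fE; rewrite /untwist (sw_lin _ _ _ fl).
transitivity (sw h s (fun a b => sw h x (fun p q => sw h a (fun u v =>
    tau (p * u) (t * y * (S (S b) * S v) * S q))))); last first.
  apply: eq_sw => a b; rewrite swM; last exact: untwist_inner.
  by do 2!apply: eq_sw => ? ?; rewrite hSM !mulrA.
rewrite sw_exchange; apply: eq_sw => p q; rewrite sw_assoc; last first.
  split=> u v c w w'.
  - by rewrite mulrDr -scalerAr (tau1 (t * y * (S (S v) * S u) * S q)).
  - rewrite linearP mulrDr -scalerAr mulrDr -scalerAr mulrDl -scalerAl.
    by rewrite (tau2 (p * u)).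
  - rewrite 2!linearP mulrDl -scalerAl mulrDr -scalerAr mulrDl -scalerAl.
    by rewrite (tau2 (p * u)).
rewrite (sw_contract_r (sw_SSr h)
  (G := fun a z => tau (p * a) (t * y * z * S q))) ?mulr1.
  by rewrite fE mulrA.
split=> u c v w.
  by rewrite mulrDr -scalerAr (tau1 (t * y * u * S q)).
by rewrite mulrDr -scalerAr mulrDl -scalerAl (tau2 (p * u)).
Qed.

Lemma ext_rep_equivariant (f : bmor M M) s t y :
  (forall u v, f (tau u v) = tau (u * s) (t * v)) ->
  is_cob d (fun p => adm_map ad f (ext_rep y p) - ext_rep (t * y * nakayama s) p).
Proof.
move=> fE.
(* The difference to be shown trivial is a sum over the Sweedler terms of s, each the image of the
   coboundary e s_1 - xi(s_1) e under a module map. *)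
have cobs : is_cob d (fun p => \sum_(q <- hD h s)
    (untwist ((e p : B) * q.1 - ext_char q.1 *: (e p : B))
       (t * y * S (S q.2)) : adM)).
  apply: cob_sum => q.
  exact: (cob_comp (mklin (@untwist_linear (t * y * S (S q.2)))) (ext_charP q.1)).
apply: (cob_ext _ cobs) => p.
rewrite adm_mapE !ext_repE (untwist_mul _ _ (linearP f) fE).
rewrite nakayama_sw (sw_lin _ _ (g := fun z => t * y * z)); last by lin.
rewrite (sw_lin _ _ _ (untwist_bilin.2 (e p))) /sw -sumrB; apply: eq_bigr => q _.
rewrite -scalerAr (linear_scale (untwist_bilin.2 (e p))).
rewrite [_ - ext_char q.1 *: (e p : B)]addrC [RHS]addrC.
have := untwist_bilin.1 (t * y * S (S q.2)) (- ext_char q.1) (e p) ((e p : B) * q.1).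
by rewrite !scaleNr.
Qed.

Lemma winding_linear : linear winding.
Proof.
by apply: sw_linear; split=> u c v w;
  rewrite ?ext_char_linear ?scalerDl ?scalerDr ?scalerA // mulrC.
Qed.

Lemma nakayama1 : nakayama 1 = 1.
Proof.
rewrite nakayama_sw sw1 ?ext_char1 ?scale1r ?hS1 //.
split=> u c v w; first by rewrite ext_char_linear scalerDl scalerA.
by rewrite 2!linearP scalerDr !scalerA mulrC.
Qed.

Definition unwinding (s : B) : B := sw h s (fun a b => ext_char (S a) *: b).

Lemma unwinding_linear : linear unwinding.
Proof.
apply: sw_linear; split=> u c v w; last by rewrite scalerDr !scalerA mulrC.
by rewrite linearP ext_char_linear scalerDl scalerA.
Qed.

Let char_pair_trilin (f : {linear B -> B}) (g : {linear B -> B}) :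
  trilin (fun a b c : B => ext_char (f a * g b) *: c).
Proof.
split=> u v c w w'; last by rewrite scalerDr !scalerA mulrC.
  by rewrite linearP mulrDl -scalerAl ext_char_linear scalerDl scalerA.
by rewrite linearP mulrDr -scalerAr ext_char_linear scalerDl scalerA.
Qed.

Let char_bilin : bilin (fun t b : B => ext_char t *: b).
Proof.
by split=> u c v w; rewrite ?ext_char_linear ?scalerDl ?scalerDr ?scalerA // mulrC.
Qed.

Lemma windingK : cancel winding unwinding.
Proof.
move=> s; rewrite {1}/winding (sw_lin _ _ _ unwinding_linear).
transitivity (sw h s (fun a b => sw h b (fun c d => ext_char (a * S c) *: d))).
  apply: eq_sw => a b; rewrite (linear_scale unwinding_linear) /unwinding.
  rewrite /sw scaler_sumr; apply: eq_bigr => q _.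
  by rewrite scalerA ext_charM.
rewrite -sw_assoc; last exact: (char_pair_trilin idfun S).
by rewrite (sw_contract_l (sw_Sr h) s char_bilin) ext_char1 scale1r.
Qed.

Lemma unwindingK : cancel unwinding winding.
Proof.
move=> s; rewrite {1}/unwinding (sw_lin _ _ _ winding_linear).
transitivity (sw h s (fun a b => sw h b (fun c d => ext_char (S a * c) *: d))).
  apply: eq_sw => a b; rewrite (linear_scale winding_linear) /winding.
  rewrite /sw scaler_sumr; apply: eq_bigr => q _.
  by rewrite scalerA ext_charM.
rewrite -sw_assoc; last exact: (char_pair_trilin S idfun).
by rewrite (sw_contract_l (sw_Sl h) s char_bilin) ext_char1 scale1r.
Qed.

Lemma antipode_bij : bijective nakayama -> bijective S.
Proof.
case=> g gK Kg; have SS s : S (S s) = nakayama (unwinding s).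
  by rewrite /nakayama unwindingK.
have Sinj : injective S.
  move=> s t st; apply: (can_inj unwindingK); apply: (can_inj gK).
  by rewrite -!SS st.
(* As S^2 is nu after the unwinding map, S^2 has inverse [winding] after g; one more S gives the
   inverse of S. *)
exists (fun s => S (winding (g s))) => s; last by rewrite SS windingK Kg.
by apply: Sinj; rewrite SS windingK Kg.
Qed.

Lemma nakayama_inj_surj : injective nakayama -> (forall y, exists s, nakayama s = y) ->
  bijective S.
Proof.
move=> inj /choice [g gP]; apply: antipode_bij; exists g => // s.
by apply: inj; rewrite gP.
Qed.

End Half.

(** * Comparison of the left and right descriptions *)

(** The interface between the two halves: [c y] represents the class of y, and the existential
    quantifiers hide the generator and its character, which differ on the two sides. *)
Lemma ext_tensor_structure (k : fieldType) (A B : algType k)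
    (ad : ad_functor A B) (h : hopf_data B) (M : bimod A) (tau : B -> B -> M) d :
  bilin tau ->
  (forall m, exists s : seq (B * B), m = \sum_(p <- s) tau p.1 p.2) ->
  (forall (W : lmodType k) (F : B -> B -> W), bilin F ->
     exists L : {linear M -> W}, forall x y, L (tau x y) = F x y) ->
  (forall b x y,
     ad_act ad b (tau x y) = sw h b (fun p q => tau (p * x) (y * hS h q))) ->
  left_noetherian B ->
  has_dim (Ext d (trivial_module (ad_eps ad)) (B^o : lmodType B)) 1 ->
  exists (c : B -> {linear iter d (@syz B) (trivial_module (ad_eps ad)) -> adm ad M})
         (nu : B -> B),
  [/\ forall f : {linear iter d (@syz B) (trivial_module (ad_eps ad)) -> adm ad M},
        exists y, is_cob d (fun p => f p - c y p),
      forall y y', is_cob d (fun p => c y p - c y' p) -> y = y',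
      forall (f : bmor M M) s t y,
        (forall u v, f (tau u v) = tau (u * s) (t * v)) ->
        is_cob d (fun p => adm_map ad f (c y p) - c (t * y * nu s) p),
      nu 1 = 1
    & injective nu -> (forall y, exists s, nu s = y) -> bijective (hS h)].
Proof.
move=> tb ts tl ta Bn /ext_dim1 [e [e_ncob e_gen]].
exists (fun y => ext_rep tb ta e y), (nakayama h e_gen); split.
- move=> f; exact: ext_rep_surj.
- move=> y y' cy; apply/eqP; rewrite -subr_eq0; apply/eqP.
  apply: (ext_rep_inj ts tl e_ncob) => //.
  by apply: (cob_ext _ cy) => p; rewrite ext_repB.
- by move=> f s t y fE; apply: ext_rep_equivariant.
- exact: nakayama1.
- exact: nakayama_inj_surj.
Qed.

(** * The outer bimodule on the tensor square and its inner endomorphisms *)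

Section TensorBimodule.
Variables (k : fieldType) (A : algType k).

Let bilinE (U V W : lmodType k) (f : U -> V -> W) :
  bilin f -> bilinear_for *:%R *:%R f.
Proof. by move=> [fl fr]; split=> u; [apply: fl | apply: fr]. Qed.

Lemma tensor_ext (V W U : lmodType k) (f g : tensor V W -> U) :
  linear f -> linear g -> (forall v w, f (tens v w) = g (tens v w)) -> f =1 g.
Proof.
move=> fl gl fg t; have [s ->] := tensor_span t.
by rewrite (linear_fun_sum fl) (linear_fun_sum gl); apply: eq_bigr.
Qed.

Section Lift.
Variables (f : A -> A -> tensor A A) (fb : bilin f).

Definition tlift : {linear tensor A A -> tensor A A} :=
  mklin (tensor_lift_linear (bilinE fb)).

Lemma tliftE x y : tlift (tens x y) = f x y.
Proof. by rewrite /tlift /mklin /= tensor_liftE //; apply: bilinE. Qed.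

End Lift.

Let sandwich_bilin (a s t b : A) :
  bilin (fun x y : A => tens (a * x * s) (t * y * b) : tensor A A).
Proof.
by split=> u c v w; rewrite mulrDr mulrDl -scalerAr -scalerAl ?tensPl ?tensPr.
Qed.

(** The outer parameters a, b give the bimodule structure and the inner ones s, t its endomorphisms;
    in one family, all compatibilities reduce to [sandwich_comp]. *)
Definition sandwich a s t b := tlift (sandwich_bilin a s t b).

Lemma sandwichE a s t b x y :
  sandwich a s t b (tens x y) = tens (a * x * s) (t * y * b).
Proof. exact: tliftE. Qed.

Lemma sandwich_comp a s t b a' s' t' b' m :
  sandwich a s t b (sandwich a' s' t' b' m) =
  sandwich (a * a') (s' * s) (t * t') (b' * b) m.
Proof.
apply: (tensor_ext (f := fun m => sandwich a s t b (sandwich a' s' t' b' m))).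
- by move=> c u v; rewrite !linearP.
- exact: linearP.
- by move=> x y; rewrite !sandwichE !mulrA.
Qed.

Lemma sandwich1 m : sandwich 1 1 1 1 m = m.
Proof.
apply: (tensor_ext (g := id)) => //; first exact: linearP.
by move=> x y; rewrite sandwichE !mulr1 !mul1r.
Qed.

Lemma sandwich_linear_l s t b m : linear (fun a => sandwich a s t b m).
Proof.
move=> c a a'; apply: (tensor_ext (f := sandwich (c *: a + a') s t b)
  (g := fun m => c *: sandwich a s t b m + sandwich a' s t b m)).
- exact: linearP.
- move=> c' u v; rewrite (linearP (sandwich a s t b)) (linearP (sandwich a' s t b)).
  by rewrite !scalerDr !scalerA mulrC addrACA.
- by move=> x y; rewrite !sandwichE !mulrDl -!scalerAl tensPl.
Qed.

Lemma sandwich_linear_r a s t m : linear (fun b => sandwich a s t b m).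
Proof.
move=> c b b'; apply: (tensor_ext (f := sandwich a s t (c *: b + b'))
  (g := fun m => c *: sandwich a s t b m + sandwich a s t b' m)).
- exact: linearP.
- move=> c' u v; rewrite (linearP (sandwich a s t b)) (linearP (sandwich a s t b')).
  by rewrite !scalerDr !scalerA mulrC addrACA.
- by move=> x y; rewrite !sandwichE !mulrDr -!scalerAr tensPr.
Qed.

Program Definition tensor_bimod : bimod A :=
  @Bimod k A (tensor A A) (fun a => sandwich a 1 1 1) (fun b => sandwich 1 1 1 b)
    _ _ _ _ _ _ _.
Next Obligation.
by split=> u; [apply: sandwich_linear_l | apply: linearP].
Qed.
Next Obligation.
by split=> u; [apply: sandwich_linear_r | apply: linearP].
Qed.
Next Obligation. exact: sandwich1. Qed.
Next Obligation. exact: sandwich1. Qed.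
Next Obligation. by move=> a b x; cbv beta; rewrite sandwich_comp !mulr1. Qed.
Next Obligation. by move=> a b x; cbv beta; rewrite sandwich_comp !mulr1. Qed.
Next Obligation. by move=> a b x; cbv beta; rewrite !sandwich_comp !mulr1 !mul1r. Qed.

Program Definition inner_mor s t : bmor tensor_bimod tensor_bimod :=
  @Bmor k A tensor_bimod tensor_bimod (sandwich 1 s t 1) _ _.
Next Obligation.
move=> s t a x.
change (sandwich 1 s t 1 (sandwich a 1 1 1 x) = sandwich a 1 1 1 (sandwich 1 s t 1 x)).
by rewrite !sandwich_comp !mulr1 !mul1r.
Qed.
Next Obligation.
move=> s t a x.
change (sandwich 1 s t 1 (sandwich 1 1 1 a x) = sandwich 1 1 1 a (sandwich 1 s t 1 x)).
by rewrite !sandwich_comp !mulr1 !mul1r.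
Qed.

Definition btens (x y : A) : tensor_bimod := tens x y.

Lemma inner_morE s t x y : inner_mor s t (btens x y) = btens (x * s) (t * y).
Proof. by rewrite [LHS]sandwichE mul1r mulr1. Qed.

Lemma lact_btens a x y : lact a (btens x y) = btens (a * x) y.
Proof. by rewrite [LHS]sandwichE mul1r !mulr1. Qed.

Lemma ract_btens a x y : ract a (btens x y) = btens x (y * a).
Proof. by rewrite [LHS]sandwichE !mul1r mulr1. Qed.

Lemma btens_bilin : bilin btens.
Proof. by split=> u c v w; rewrite /btens ?tensPl ?tensPr. Qed.

Lemma btens_span (m : tensor_bimod) :
  exists s : seq (A * A), m = \sum_(p <- s) btens p.1 p.2.
Proof. exact: tensor_span. Qed.

Lemma btens_lift (W : lmodType k) (F : A -> A -> W) : bilin F ->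
  exists L : {linear tensor_bimod -> W}, forall x y, L (btens x y) = F x y.
Proof.
move=> Fb; exists (mklin (tensor_lift_linear (bilinE Fb))) => x y.
by rewrite /mklin /= tensor_liftE //; apply: bilinE.
Qed.

End TensorBimodule.

Lemma cob_chain (R : nzRingType) (T N : lmodType R) n (f g l : iter n (@syz R) T -> N) :
  is_cob n (fun x => f x - g x) -> is_cob n (fun x => g x - l x) ->
  is_cob n (fun x => f x - l x).
Proof.
move=> fg gl; apply: (cob_ext _ (cobD fg gl)) => x.
by rewrite addrA subrK.
Qed.

Lemma cob_sym (R : nzRingType) (T N : lmodType R) n (f g : iter n (@syz R) T -> N) :
  is_cob n (fun x => f x - g x) -> is_cob n (fun x => g x - f x).
Proof. by move=> fg; apply: (cob_ext _ (cobN fg)) => x; rewrite opprB. Qed.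

(** * Matching Ext classes across two adjoint modules *)

Section Transfer.
Variables (k : fieldType) (A B B' : algType k).
Variables (ad : ad_functor A B) (ad' : ad_functor A B').
Variables (acy : coind_acyclic ad) (acy' : coind_acyclic ad').
Variables (M : bimod A) (d : nat).
Local Notation Y := (iter d (@syz B) (trivial_module (ad_eps ad))).
Local Notation Y' := (iter d (@syz B') (trivial_module (ad_eps ad'))).

(* f and f' represent the same class under Ext_B^d(k, M) = Ext_B'^d(k, M). *)
Definition same_class (f : {linear Y -> adm ad M}) (f' : {linear Y' -> adm ad' M}) :=
  exists z : cosyz d M, dim_shift f z /\ dim_shift f' z.

Lemma same_class_total f : exists f', same_class f f'.
Proof.
have [z fz] := dim_shift_total acy f.
have [f' f'z] := dim_shift_surj ad' (dim_shift_central fz).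
by exists f', z.
Qed.

Lemma same_class_map (a : bmor M M) f f' : same_class f f' ->
  same_class (adm_map ad a \o f) (adm_map ad' a \o f').
Proof.
by move=> [z [fz fz']]; exists (cosyz_map d a z); split; apply: dim_shift_map.
Qed.

Lemma same_class_cob f f' g g' : same_class f f' -> same_class g g' ->
  is_cob d (fun x => f x - g x) -> is_cob d (fun x => f' x - g' x).
Proof.
move=> [z [fz fz']] [w [gw gw']] fg.
apply/(dim_shift_cob acy' (dim_shiftB fz' gw')).
exact/(dim_shift_cob acy (dim_shiftB fz gw)).
Qed.

End Transfer.

Lemma same_class_sym (k : fieldType) (A B B' : algType k)
  (ad : ad_functor A B) (ad' : ad_functor A B') (M : bimod A) d
  (f : {linear iter d (@syz B) (trivial_module (ad_eps ad)) -> adm ad M})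
  (f' : {linear iter d (@syz B') (trivial_module (ad_eps ad')) -> adm ad' M}) :
  same_class f f' -> same_class f' f.
Proof. by move=> [z [fz fz']]; exists z. Qed.

Theorem corollary0p3 (k : fieldType) (H : hopfAlgType k)
  (H_noeth : noetherian H) (H_ASG : AS_Gorenstein H) :
  bijective (antipode H).
Proof.
have [Hl Hr] := H_noeth; have [d [_ _ dimL] [_ _ dimR]] := H_ASG.
pose h := hopf_of H.
pose adl := @ad_left k H h (counit H) (fun=> erefl).
pose adr := @ad_right k H h (@counitc k H) (fun=> erefl).
pose M := tensor_bimod H.
have acl : coind_acyclic adl by exact: ad_left_acyclic.
have acr : coind_acyclic adr by exact: ad_right_acyclic.
have [|c [nu [c_surj c_inj c_eq nu1 nu_bij]]] :=
  @ext_tensor_structure k H H adl h M (@btens k H) d (@btens_bilin k H)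
    (@btens_span k H) (@btens_lift k H) _ Hl dimL.
  move=> b x y; apply: eq_sw => p q.
  by rewrite ract_btens lact_btens.
(* For right modules the factor to be untwisted is the right-hand one, hence the exchange. *)
pose tau' (x y : H^c) : M := btens (y : H) x.
have tau'_bilin : bilin tau' by have [b1 b2] := btens_bilin H; split.
have tau'_span m : exists s : seq (H^c * H^c), m = \sum_(p <- s) tau' p.1 p.2.
  have [s ->] := btens_span m; exists [seq (p.2, p.1) | p <- s].
  by rewrite big_map.
have tau'_lift (W : lmodType k) (F : H^c -> H^c -> W) : bilin F ->
    exists L : {linear M -> W}, forall x y, L (tau' x y) = F x y.
  move=> [F1 F2]; have Fb : bilin (fun x y : H => F y x) by split.
  by have [L LE] := btens_lift Fb; exists L => x y; rewrite LE.
have [|c' [nu' [c'_surj c'_inj c'_eq nu'1 _]]] :=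
  @ext_tensor_structure k H H^c adr (opcop h) M tau' d tau'_bilin
    tau'_span tau'_lift _ Hr dimR.
  move=> b x y; apply: eq_sw => p q.
  by rewrite [ract _ _]lact_btens [LHS]ract_btens.
pose mu : H -> H := nu'.
have mu1 : mu 1 = 1 := nu'1.
(* Q is the graph of the bijection F, kept as a relation because classes are compared through
   representatives. *)
pose Q (y y' : H) := exists f f', [/\ same_class f f',
  is_cob d (fun p => f p - c y p) & is_cob d (fun p => f' p - c' y' p)].
have Q_total y : exists y', Q y y'.
  have [f' ff'] := same_class_total adr acl (c y).
  have [y' f'y'] := c'_surj f'; exists y', (c y), f'; split=> //.
  by apply: (cob_ext _ (cob0 _ _ _)) => p; rewrite subrr.
have Q_onto y' : exists y, Q y y'.
  have [f ff'] := same_class_total adl acr (c' y').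
  have [y fy] := c_surj f; exists y, f, (c' y'); split=> //.
    exact: same_class_sym.
  by apply: (cob_ext _ (cob0 _ _ _)) => p; rewrite subrr.
have Q_fun y y1 y2 : Q y y1 -> Q y y2 -> y1 = y2.
  move=> [f1 [f1' [s1 c1 c1']]] [f2 [f2' [s2 c2 c2']]]; apply: c'_inj.
  apply: cob_chain (cob_sym c1') (cob_chain _ c2').
  exact: (same_class_cob acl acr s1 s2 (cob_chain c1 (cob_sym c2))).
have Q_inj y1 y2 y' : Q y1 y' -> Q y2 y' -> y1 = y2.
  move=> [f1 [f1' [s1 c1 c1']]] [f2 [f2' [s2 c2 c2']]]; apply: c_inj.
  apply: cob_chain (cob_sym c1) (cob_chain _ c2).
  exact: (same_class_cob acr acl (same_class_sym s1) (same_class_sym s2)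
    (cob_chain c1' (cob_sym c2'))).
have Q_eq s t y y' : Q y y' -> Q (t * y * nu s) (mu t * (y' * s)).
  move=> [f [f' [ff' cf cf']]].
  exists (adm_map adl (inner_mor s t) \o f), (adm_map adr (inner_mor s t) \o f').
  split; first exact: same_class_map.
    apply: cob_chain (c_eq (inner_mor s t) s t y (inner_morE s t)).
    apply: (cob_ext _ (cob_comp (adm_map adl (inner_mor s t)) cf)) => p.
    exact: linearB.
  (* With the tensor factors exchanged s and t swap roles, and the [H^c]-product of s, y' and nu'(t)
     reads mu t * (y' * s) in H. *)
  have c'e : is_cob d (fun p => adm_map adr (inner_mor s t) (c' y' p) -
      c' (mu t * (y' * s)) p) :=
    c'_eq (inner_mor s t) t s y' (fun u v => inner_morE s t v u).
  apply: cob_chain c'e.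
  apply: (cob_ext _ (cob_comp (adm_map adr (inner_mor s t)) cf')) => p.
  exact: linearB.
have [u Q1u] := Q_total 1.
have Ql s : Q (nu s) (u * s).
  by have := Q_eq s 1 _ _ Q1u; rewrite mu1 !mul1r.
have Qr t : Q t (mu t * u).
  by have := Q_eq 1 t _ _ Q1u; rewrite nu1 !mulr1.
(* The preimage t of 1 under F yields the left inverse nu'(t) of u. *)
have [t Qt1] := Q_onto 1.
have wu : mu t * u = 1 by exact: Q_fun (Qr t) Qt1.
have uw : u * mu t = 1 := left_noetherian_mulr_eq1 Hl wu.
apply: nu_bij => [s s' ss'|y].
  have us : u * s = u * s' by apply: Q_fun (Ql s) _; rewrite ss'.
  by rewrite -[s]mul1r -wu -mulrA us mulrA wu mul1r.
(* The element s is chosen so that u s = y' = F(y); then F(nu(s)) = F(y), and F is injective. *)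
have [y' Qy] := Q_total y; exists (mu t * y').
by apply: Q_inj Qy; have := Ql (mu t * y'); rewrite mulrA uw mul1r.
Qed.
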